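(* Let $(M^{2m},\varphi,g)$ be a para-Kähler-Norden manifold and $T^{\varphi}_{1}M$ its $\varphi$-unit tangent bundle equipped with the $\varphi$-Sasaki metric. If $\Gamma=(\gamma(t),\gamma_t'(t))$ is a natural lift of $\gamma$, $\Gamma$ lies in $T^{\varphi}_{1}M$, and $\Gamma$ is naturally parameterized, then $\Gamma$ is a geodesic on $T^{\varphi}_{1}M$ if and only if $\gamma$ is a geodesic on $M$.
   Context: A para-Kähler-Norden manifold $(M^{2m},\varphi,g)$ is a $2m$-dimensional Riemannian manifold $(M,g)$ with a $(1,1)$-tensor field $\varphi$ such that $\varphi^2=\mathrm{id}$, $\varphi\ne\pm\mathrm{id}$, the $+1$ and $-1$ eigenbundles of $\varphi$ have equal rank, $g(\varphi X,Y)=g(X,\varphi Y)$, and $\nabla\varphi=0$, where $\nabla$ is the Levi-Civita connection of $g$; $|\cdot|$ is the norm of $g$. Points of $TM$ are written $(x,\xi)$; ${}^{H}X$, ${}^{V}X$ are the horizontal (with respect to $\nabla$) and vertical lifts to $TM$. The $\varphi$-Sasaki metric $g^\varphi$ on $TM$ is defined by $g^\varphi({}^HX,{}^HY)=g(X,Y)$, $g^\varphi({}^HX,{}^VY)=0$, $g^\varphi({}^VX,{}^VY)=g(X,\varphi Y)$. The $\varphi$-unit tangent bundle is the hypersurface $T^{\varphi}_{1}M=\{(x,\xi)\in TM: g(\xi,\varphi\xi)=1\}$, equipped with the metric induced by $g^\varphi$; $\widehat\nabla$ is the Levi-Civita connection of this induced metric. A curve $\Gamma=(\gamma(t),\xi(t))$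 consists of a curve $\gamma$ on $M$ and a vector field $\xi$ along $\gamma$. Write $\gamma_t'=d\gamma/dt$, $\gamma_t''=\nabla_{\gamma_t'}\gamma_t'$, $\xi_t'=\nabla_{\gamma_t'}\xi$; then $\Gamma_t'={}^H\gamma_t'+{}^V\xi_t'$. The natural lift of $\gamma$ is $\Gamma=(\gamma(t),\gamma_t'(t))$, i.e. $\xi=\gamma_t'$. $\Gamma$ is naturally parameterized if $t$ is an arc length parameter, i.e. $g^\varphi(\Gamma_t',\Gamma_t')=|\gamma_t'|^2+g(\xi_t',\varphi\xi_t')=1$. $\Gamma$ is a geodesic on $T^\varphi_1M$ if $\widehat\nabla_{\Gamma_t'}\Gamma_t'=0$; $\gamma$ is a geodesic on $M$ if $\gamma_t''=0$. *)

(* Defs.v *)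
From HB Require Import structures.
From mathcomp Require Import all_boot all_order all_algebra.
From mathcomp Require Import all_classical all_reals all_analysis.
From mathcomp Require Import ring.
Set Implicit Arguments.
Unset Strict Implicit.
Unset Printing Implicit Defensive.
Import Order.TTheory GRing.Theory Num.Theory.
Import numFieldNormedType.Exports.
Local Open Scope ring_scope.
Local Open Scope classical_set_scope.

(* Conventions.  Tangent vectors in a chart are row vectors, so linear maps act
   on the right: [v *m 'J f x] is the differential of [f] at [x] applied to
   [v], and an endomorphism with matrix [A] maps [v] to [v *m A].             *)

Section LocalCalculus.
Variable R : realType.

(* All uses below have [U] open.  In finite dimension, [f] is C^(k+1) on [U]
   iff it is differentiable on [U] and all its directional derivatives are C^k
   on [U].                                                                    *)
Fixpoint Ck (k : nat) (V W : normedModType R) (U : set V) (f : V -> W)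
    {struct k} : Prop :=
  if k is k'.+1 then
    (forall x, U x -> differentiable f x) /\
    (forall v : V, Ck k' U (fun x => 'D_v f x))
  else forall x, U x -> {for x, continuous f}.

Definition smooth_on (V W : normedModType R) (U : set V) (f : V -> W) : Prop :=
  forall k, Ck k U f.

Definition partial n (i : 'I_n) (f : 'rV[R]_n -> R) (x : 'rV[R]_n) : R :=
  'D_(delta_mx 0 i) f x.

Definition bil n (A : 'M[R]_n) (v w : 'rV[R]_n) : R := (v *m A *m w^T) 0 0.

End LocalCalculus.

Section LeviCivita.
Variable R : realType.
Variable n : nat.
(* Components of a pseudo-Riemannian metric in a chart. *)
Variable G : 'rV[R]_n -> 'M[R]_n.

(* [christoffel x i j k] is the symbol Gamma^k_(ij), with upper index [k]. *)
Definition christoffel (x : 'rV[R]_n) (i j k : 'I_n) : R :=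
  2^-1 * \sum_l (partial i (fun y => G y j l) x
                 + partial j (fun y => G y i l) x
                 - partial l (fun y => G y i j) x) * invmx (G x) l k.

(* The symbols above are those of the unique torsion-free metric connection. *)
Lemma christoffel_levi_civita (x : 'rV[R]_n) (C : 'I_n -> 'I_n -> 'I_n -> R) :
  G x \in unitmx -> (\forall y \near x, (G y)^T = G y) ->
  (forall i j k, C i j k = christoffel x i j k) <->
  ((forall i j k, C i j k = C j i k) /\
   (forall i j k, partial i (fun y => G y j k) x =
      \sum_l C i j l * G x l k + \sum_l C i k l * G x j l)).
Proof.
move=> Gu Gs.
have sG j l : G x j l = G x l j.
  by move: (nbhs_singleton Gs) => /matrixP/(_ j l); rewrite mxE.
have sdG i j l : partial i (fun y => G y j l) x = partial i (fun y => G y l j) x.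
  apply: near_eq_derive; near=> y.
  have /matrixP/(_ j l) : (G y)^T = G y by near: y; exact: Gs.
  by rewrite mxE.
pose K i j l := partial i (fun y => G y j l) x + partial j (fun y => G y i l) x
                 - partial l (fun y => G y i j) x.
have low i j k : \sum_l christoffel x i j l * G x l k = 2^-1 * K i j k.
  have -> : \sum_l christoffel x i j l * G x l k =
      2^-1 * ((\row_l K i j l) *m invmx (G x) *m G x) 0 k.
    rewrite mxE big_distrr /=; apply: eq_bigr => l _.
    rewrite /christoffel -mulrA; congr (_ * (_ * _)).
    by rewrite mxE; apply: eq_bigr => p _; rewrite mxE.
  by rewrite mulmxKV // mxE.
split=> [CE|[tors metr] i j k].
  split=> [i j k|i j k].
    rewrite !CE /christoffel; congr (_ * _); apply: eq_bigr => l _.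
    by rewrite (sdG l i j) [X in (X - _) * _]addrC.
  have -> : \sum_l C i k l * G x j l = \sum_l christoffel x i k l * G x l j.
    by apply: eq_bigr => l _; rewrite CE sG.
  under eq_bigr do rewrite CE.
  by rewrite !low /K (sdG i k j) (sdG j i k) (sdG k i j); field.
have CK p q r : \sum_l C p q l * G x l r = 2^-1 * K p q r.
  pose c a b d := \sum_l C a b l * G x l d.
  have cs a b d : c a b d = c b a d by apply: eq_bigr => l _; rewrite tors.
  have M a b d : partial a (fun y => G y b d) x = c a b d + c a d b.
    by rewrite metr; congr (_ + _); apply: eq_bigr => l _; rewrite sG.
  by rewrite -/(c p q r) /K !M (cs q p r) (cs r p q) (cs r q p); field.
have : \row_l C i j l = \row_l christoffel x i j l.
  apply: (can_inj (mulmxK Gu)); apply/rowP => r; rewrite !mxE.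
  under eq_bigr do rewrite mxE.
  by rewrite CK -low; apply: eq_bigr => l _; rewrite mxE.
by move=> /rowP/(_ k); rewrite !mxE.
Unshelve. all: by end_near.
Qed.

(* Connection matrix: [u *m conn_mx x v] has components
   Gamma^k_(ij) u^i v^j.                                                      *)
Definition conn_mx (x v : 'rV[R]_n) : 'M[R]_n :=
  \matrix_(i, k) \sum_j christoffel x i j k * v 0 j.

(* The covariant derivative nabla_(x') X of a vector field X along x. *)
Definition cov_along (x X : R -> 'rV[R]_n) (t : R) : 'rV[R]_n :=
  derive1 X t + derive1 x t *m conn_mx (x t) (X t).

Definition geodesic_at (x : R -> 'rV[R]_n) (t : R) : Prop :=
  cov_along x (derive1 x) t = 0.

(* Component on d_j of (nabla_k A) d_i for an endomorphism field [A]. *)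
Definition nabla_endo (A : 'rV[R]_n -> 'M[R]_n) (x : 'rV[R]_n)
    (k i j : 'I_n) : R :=
  partial k (fun y => A y i j) x
  + \sum_l A x i l * christoffel x k l j
  - \sum_l christoffel x k i l * A x l j.

End LeviCivita.

Section Sasaki.
Variable R : realType.
Variable n : nat.
(* Components of the metric and of the endomorphism field in a chart; a point
   of the tangent bundle over this chart is [row_mx x v], with [v] the
   components of a tangent vector at [x].                                     *)
Variables g phi : 'rV[R]_n -> 'M[R]_n.

Definition hlift (z : 'rV[R]_(n + n)) (a : 'rV[R]_n) : 'rV[R]_(n + n) :=
  row_mx a (- (a *m conn_mx g (lsubmx z) (rsubmx z))).

Definition vlift (b : 'rV[R]_n) : 'rV[R]_(n + n) := row_mx 0 b.

(* [w *m hor_mx] and [w *m ver_mx z] are the vectors X and Y such that [w] is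
   the sum of the horizontal lift of X and the vertical lift of Y.            *)
Definition hor_mx : 'M[R]_(n + n, n) := col_mx 1%:M 0.
Definition ver_mx (z : 'rV[R]_(n + n)) : 'M[R]_(n + n, n) :=
  col_mx (conn_mx g (lsubmx z) (rsubmx z)) 1%:M.

Definition sasaki (z : 'rV[R]_(n + n)) : 'M[R]_(n + n) :=
  hor_mx *m g (lsubmx z) *m hor_mx^T
  + ver_mx z *m (g (lsubmx z) *m (phi (lsubmx z))^T) *m (ver_mx z)^T.

Lemma lift_decomp z w : w = hlift z (w *m hor_mx) + vlift (w *m ver_mx z).
Proof.
rewrite -(hsubmxK w); move: (lsubmx w) (rsubmx w) => a b.
rewrite /hlift /vlift /hor_mx /ver_mx !mul_row_col !mulmx1 mulmx0.
by rewrite add_row_mx !(addr0 a) (addKr (a *m _) b).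
Qed.

Let hlift_hor z a : hlift z a *m hor_mx = a.
Proof. by rewrite /hlift /hor_mx mul_row_col mulmx1 mulmx0 (addr0 a). Qed.

Let hlift_ver z a : hlift z a *m ver_mx z = 0.
Proof. by rewrite /hlift /ver_mx mul_row_col mulmx1 (subrr (a *m _)). Qed.

Let vlift_hor b : vlift b *m hor_mx = 0.
Proof. by rewrite /vlift /hor_mx mul_row_col mul0mx mulmx0 (addr0 (0 : 'rV_n)). Qed.

Let vlift_ver z b : vlift b *m ver_mx z = b.
Proof. by rewrite /vlift /ver_mx mul_row_col mul0mx mulmx1 (add0r b). Qed.

Let sasakiE z w w' : bil (sasaki z) w w' =
  bil (g (lsubmx z)) (w *m hor_mx) (w' *m hor_mx)
  + bil (g (lsubmx z)) (w *m ver_mx z) (w' *m ver_mx z *m phi (lsubmx z)).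
Proof.
by rewrite /bil /sasaki mulmxDr mulmxDl mxE !trmx_mul !mulmxA.
Qed.

(* The defining identities of the phi-Sasaki metric. *)
Lemma sasaki_hh z a b :
  bil (sasaki z) (hlift z a) (hlift z b) = bil (g (lsubmx z)) a b.
Proof.
by rewrite sasakiE !hlift_hor !hlift_ver /bil !mul0mx [X in _ + X]mxE addr0.
Qed.

Lemma sasaki_hv z a b : bil (sasaki z) (hlift z a) (vlift b) = 0.
Proof.
by rewrite sasakiE hlift_hor hlift_ver vlift_hor /bil trmx0 !mul0mx mulmx0 !mxE addr0.
Qed.

Lemma sasaki_vv z a b : bil (sasaki z) (vlift a) (vlift b) =
  bil (g (lsubmx z)) a (b *m phi (lsubmx z)).
Proof.
by rewrite sasakiE !vlift_hor !vlift_ver /bil !mul0mx [X in X + _]mxE add0r.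
Qed.

End Sasaki.

Section Submanifold.
Variable R : realType.
Variables d k : nat.

(* [F] is a diffeomorphism from the open set [V] of R^k onto the relatively
   open subset [S `&` W] of [S]; its inverse is the restriction of a map [H]
   that is smooth on the open set [W] of R^d.                                 *)
Definition submfd_chart (S : set 'rV[R]_d) (V : set 'rV[R]_k)
    (W : set 'rV[R]_d) (F : 'rV[R]_k -> 'rV[R]_d) (H : 'rV[R]_d -> 'rV[R]_k) :
    Prop :=
  [/\ open V /\ open W, smooth_on V F, smooth_on W H, F @` V = S `&` W
    & forall y, V y -> H (F y) = y].

Definition induced_metric (G : 'rV[R]_d -> 'M[R]_d)
    (F : 'rV[R]_k -> 'rV[R]_d) (y : 'rV[R]_k) : 'M[R]_k :=
  'J F y *m G (F y) *m ('J F y)^T.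

(* The curve [c], lying in the [k]-dimensional submanifold [S], satisfies at
   [t] the geodesic equation of the metric induced on [S] by [G].             *)
Definition submfd_geodesic_at (S : set 'rV[R]_d) (G : 'rV[R]_d -> 'M[R]_d)
    (c : R -> 'rV[R]_d) (t : R) : Prop :=
  forall V W F H, submfd_chart S V W F H -> W (c t) ->
    geodesic_at (induced_metric G F) (H \o c) t.

End Submanifold.

Record manifold (R : realType) (n : nat) := Manifold {
  mcarrier :> topologicalType;
  _ : hausdorff_space mcarrier;
  _ : @second_countable mcarrier;
  mchart : Type;
  mdom : mchart -> set mcarrier;
  mcoord : mchart -> mcarrier -> 'rV[R]_n;
  mparam : mchart -> 'rV[R]_n -> mcarrier;
  mdom_open : forall i, open (mdom i);
  mdom_cover : forall p, exists i, mdom i p;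
  mcoord_open : forall i, open (mcoord i @` mdom i);
  mcoordK : forall i p, mdom i p -> mparam i (mcoord i p) = p;
  mcoord_continuous : forall i p, mdom i p -> {for p, continuous (mcoord i)};
  mparam_continuous : forall i x,
    (mcoord i @` mdom i) x -> {for x, continuous (mparam i)};
  mtrans_smooth : forall i j,
    smooth_on (mcoord i @` (mdom i `&` mdom j)) (mcoord j \o mparam i)
}.

Definition mimg R n (M : manifold R n) (i : mchart M) : set 'rV[R]_n :=
  mcoord i @` mdom i.

Definition trans_jac R n (M : manifold R n) (i j : mchart M) (p : M) :
    'M[R]_n :=
  'J (mcoord j \o mparam i) (mcoord i p).

(* Tensor fields are given by their components in every chart of the atlas,
   subject to the transformation law on overlaps.                             *)
Record riemannian (R : realType) (n : nat) := Riemannian {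
  rman :> manifold R n;
  metric : mchart rman -> 'rV[R]_n -> 'M[R]_n;
  metric_smooth : forall i, smooth_on (mimg i) (metric i);
  metric_trans : forall i j p, mdom i p -> mdom j p ->
    metric i (mcoord i p) =
      trans_jac i j p *m metric j (mcoord j p) *m (trans_jac i j p)^T;
  metric_sym : forall i x, mimg i x -> (metric i x)^T = metric i x;
  metric_pos : forall i x, mimg i x ->
    forall v, v != 0 -> 0 < bil (metric i x) v v
}.

Record para_kahler_norden (R : realType) (m : nat) := ParaKahlerNorden {
  pkn :> riemannian R (2 * m)%N;
  phi : mchart pkn -> 'rV[R]_(2 * m)%N -> 'M[R]_(2 * m)%N;
  phi_smooth : forall i, smooth_on (mimg i) (phi i);
  phi_trans : forall i j p, mdom i p -> mdom j p ->
    phi i (mcoord i p) *m trans_jac i j p =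
      trans_jac i j p *m phi j (mcoord j p);
  phi_invol : forall i x, mimg i x -> phi i x *m phi i x = 1%:M;
  phi_neq_id : ~ (forall i x, mimg i x -> phi i x = 1%:M);
  phi_neq_opp_id : ~ (forall i x, mimg i x -> phi i x = - 1%:M);
  phi_eigen_rank : forall i x, mimg i x ->
    \rank (eigenspace (phi i x) 1) = \rank (eigenspace (phi i x) (-1));
  phi_selfadj : forall i x, mimg i x -> forall v w,
    bil (metric i x) (v *m phi i x) w = bil (metric i x) v (w *m phi i x);
  phi_parallel : forall i x, mimg i x ->
    forall k a b, nabla_endo (metric i) (phi i) x k a b = 0
}.

Section Curves.
Variables (R : realType) (n : nat) (M : riemannian R n).
Implicit Types (I : set R) (gamma : R -> M).

Definition smooth_curve I gamma : Prop :=
  (forall t, I t -> {for t, continuous gamma}) /\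
  (forall i, smooth_on (I `&` gamma @^-1` mdom i) (mcoord i \o gamma)).

(* A vector field [xi] along [gamma] is given by its components: [xi i t] is
   meaningful when [mdom i (gamma t)].                                        *)
Definition velocity gamma (i : mchart M) : R -> 'rV[R]_n :=
  derive1 (mcoord i \o gamma).

Definition geodesic I gamma : Prop :=
  forall t i, I t -> mdom i (gamma t) ->
    geodesic_at (metric i) (mcoord i \o gamma) t.

(* The curve (gamma, xi) in the chart of the tangent bundle induced by [i]. *)
Definition tcurve gamma (xi : mchart M -> R -> 'rV[R]_n) (i : mchart M)
    (t : R) : 'rV[R]_(n + n) :=
  row_mx (mcoord i (gamma t)) (xi i t).

End Curves.

Section PhiUnitTangentBundle.
Variables (R : realType) (m : nat) (M : para_kahler_norden R m).
Local Notation n := (2 * m)%N.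
Implicit Types (I : set R) (gamma : R -> M) (xi : mchart M -> R -> 'rV[R]_n).

(* The part of T^phi_1 M lying over the domain of the chart [i]. *)
Definition phi_unit (i : mchart M) : set 'rV[R]_(n + n) :=
  [set z | mimg i (lsubmx z) /\
     bil (metric i (lsubmx z)) (rsubmx z) (rsubmx z *m phi i (lsubmx z)) = 1].

Definition phi_sasaki (i : mchart M) : 'rV[R]_(n + n) -> 'M[R]_(n + n) :=
  sasaki (metric i) (phi i).

Definition lies_in_phi_unit I gamma xi : Prop :=
  forall t i, I t -> mdom i (gamma t) -> phi_unit i (tcurve gamma xi i t).

Definition naturally_parameterized I gamma xi : Prop :=
  forall t i, I t -> mdom i (gamma t) ->
    let c := tcurve gamma xi i in
    bil (phi_sasaki i (c t)) (derive1 c t) (derive1 c t) = 1.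

(* T^phi_1 M is a hypersurface, of dimension 2 n - 1. *)
Definition phi_unit_geodesic I gamma xi : Prop :=
  forall t i, I t -> mdom i (gamma t) ->
    @submfd_geodesic_at R (n + n) (n + n).-1 (phi_unit i) (phi_sasaki i)
      (tcurve gamma xi i) t.

End PhiUnitTangentBundle.

(* Main.v *)
Require Import Defs.
From HB Require Import structures.
From mathcomp Require Import all_boot all_order all_algebra.
From mathcomp Require Import all_classical all_reals all_analysis.
From mathcomp Require Import ring lra.
Import Order.TTheory GRing.Theory Num.Theory.
Import numFieldNormedType.Exports.
Local Open Scope ring_scope.
Local Open Scope classical_set_scope.
Set Implicit Arguments.
Unset Strict Implicit.
Unset Printing Implicit Defensive.

(* Being a geodesic is expressed by the vanishing of the Euler-Lagrange covector
   of the energy, which is natural under pullback: a curve in a hypersurface is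
   a geodesic of the induced metric iff its ambient Euler-Lagrange covector
   kills the tangent hyperplane.  For the phi-Sasaki metric and a natural lift
   with velocity u and acceleration u', this covector is
     - g(u'', phi b) on the vertical lift of b;
     - the lift of the Euler-Lagrange covector of g, when u' = 0 identically.
   The second formula gives the implication from M to the bundle.  Conversely,
   since g(u, phi u) = 1, the first one forces u'' = - nu u with
   nu = g(u', phi u').  As g(u', phi u) = 0, it also gives g(u'', phi u') = 0, so
   differentiating g(u, u) + nu = 1 gives g(u', u) = 0, and once more
   g(u', u') = nu g(u, u).  But phi is an isometry, so
   1 = g(u, phi u) <= g(u, u) = 1 - nu; hence nu <= 0 and u' = 0.  The curvature
   terms of the horizontal equation are not needed. *)

(** * Differential calculus of matrix-valued maps *)

(** Two features of [submfd_geodesic_at] shape the proof. It speaks of the Christoffel symbols of an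
    induced metric, which are unwieldy; the Euler-Lagrange covector avoids them, since under
    pullback the only extra terms come from the second differential of the parametrization and
    cancel by symmetry of second derivatives. It also quantifies over all charts, so to draw
    anything from the assumption that the lift is a geodesic a chart around each point of the curve
    has to be exhibited; it is built explicitly from the homogeneity of the fibre quadrics.

    The fibre geometry is carried by h(a, b) = g(a, phi b), called [twin]. Since g and phi are
    parallel, h is parallel for the connection of g. This makes differentiation of the vertical part
    of the velocity a covariant one, and makes the tautological vertical field normal to the
    hypersurface, with square 1 on it. As h may be indefinite, index raising rests on invertibility
    of matrices, and inequalities come from g alone. *)

Section Calculus.
Variable R : realType.
Implicit Types U V W : normedModType R.

Lemma derive_comp V W W' (f : V -> W) (g : W -> W') (x v : V) :
  differentiable f x -> differentiable g (f x) ->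
  'D_v (g \o f) x = 'D_('D_v f x) g (f x).
Proof.
move=> df dg; rewrite (deriveE _ (differentiable_comp df dg)) diff_comp //=.
by rewrite (deriveE _ dg) (deriveE _ df).
Qed.

Lemma derivative_linear V W W' (f : V -> W) (L : {linear W -> W'}) (x v : V) :
  continuous L -> differentiable f x ->
  differentiable (fun y => L (f y)) x /\
  'D_v (fun y => L (f y)) x = L ('D_v f x).
Proof.
move=> cL df; have dL z : differentiable L z by exact: linear_differentiable.
split; first exact: differentiable_comp.
by rewrite (derive_comp v df (dL _)) (deriveE _ (dL _)) diff_lin.
Qed.

Lemma derive_add V W (f g : V -> W) (x v : V) :
  differentiable f x -> differentiable g x ->
  'D_v (fun y => f y + g y) x = 'D_v f x + 'D_v g x.
Proof. by move=> df dg; apply: deriveD; exact: diff_derivable. Qed.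

Lemma sum_differentiable V W (T : Type) (r : seq T) (f : T -> V -> W) (x : V) :
  (forall i, differentiable (f i) x) ->
  differentiable (fun y => \sum_(i <- r) f i y) x.
Proof.
move=> df; elim: r => [|i r IH].
  rewrite (_ : (fun _ => _) = cst 0); first exact: differentiable_cst.
  by apply/funext => y; rewrite big_nil.
rewrite (_ : (fun _ => _) = f i + (fun y => \sum_(j <- r) f j y)).
  exact: differentiableD.
by apply/funext => y; rewrite big_cons.
Qed.

(** In the basis [delta_mx i j] the map is a finite sum of coordinates times fixed vectors, hence
    differentiable, whatever the normed space [W]. *)
Lemma linear_mx_continuous m n W (L : {linear 'M[R]_(m, n) -> W}) :
  continuous L.
Proof.
move=> A; apply: differentiable_continuous.
rewrite (_ : (L : _ -> _) = fun B : 'M[R]_(m, n) =>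
    \sum_i \sum_j B i j *: L (delta_mx i j)).
  apply: sum_differentiable => i; apply: sum_differentiable => j.
  exact/differentiableZl/differentiable_coord.
apply/funext => B; rewrite [in LHS](matrix_sum_delta B) linear_sum.
by apply: eq_bigr => i _; rewrite linear_sum; apply: eq_bigr => j _; rewrite linearZ.
Qed.

Lemma differentiable_mxP V m n (f : V -> 'M[R]_(m, n)) (x : V) :
  (forall i j, differentiable (fun y => f y i j) x) -> differentiable f x.
Proof.
move=> df; rewrite (_ : f = fun y => \sum_i \sum_j f y i j *: delta_mx i j).
  apply: sum_differentiable => i; apply: sum_differentiable => j.
  exact/differentiableZl/df.
by apply/funext => y; exact: matrix_sum_delta.
Qed.

Lemma differentiable_entry V m n (f : V -> 'M[R]_(m, n)) (x : V) i j :
  differentiable f x -> differentiable (fun y => f y i j) x.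
Proof.
move=> df; apply: (@differentiable_comp _ _ _ _ f (fun A : 'M[R]_(m, n) => A i j)) => //.
exact: differentiable_coord.
Qed.

Lemma derive_entry V m n (f : V -> 'M[R]_(m, n)) (x v : V) i j :
  differentiable f x -> 'D_v (fun y => f y i j) x = 'D_v f x i j.
Proof. by move=> df; rewrite derive_mx ?mxE //; exact: diff_derivable. Qed.

(** A single Leibniz rule: it serves matrix products directly and, through [Ck_bilinear], products
    and scalings of functions. *)
Lemma derivative_bilinear U V W W' (f : {bilinear V -> W -> W'})
    (A : U -> V) (B : U -> W) (x v : U) :
  continuous (fun p => f p.1 p.2) ->
  differentiable A x -> differentiable B x ->
  differentiable (fun y => f (A y) (B y)) x /\
  'D_v (fun y => f (A y) (B y)) x = f ('D_v A x) (B x) + f (A x) ('D_v B x).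
Proof.
move=> cf dA dB.
have dAB := differentiable_pair dA dB.
have df : differentiable (fun p => f p.1 p.2) (A x, B x).
  exact: differentiable_bilin.
split; first exact: (differentiable_comp dAB df).
rewrite (derive_comp v dAB df) (deriveE _ df) diff_bilin //= (deriveE _ dAB).
by rewrite diff_pair //= (deriveE _ dA) (deriveE _ dB) addrC.
Qed.

Lemma mulmx_continuous m n p :
  continuous (fun q : 'M[R]_(m, n) * 'M[R]_(n, p) => q.1 *m q.2).
Proof.
move=> q; apply: differentiable_continuous; apply: differentiable_mxP => i j.
rewrite (_ : (fun _ => _) = fun q : 'M[R]_(m, n) * 'M[R]_(n, p) =>
    \sum_k q.1 i k * q.2 k j); last by apply/funext => y; rewrite mxE.
apply: sum_differentiable => k; apply: differentiableM.
  apply: (@differentiable_comp _ _ _ _ fst (fun A : 'M[R]_(m, n) => A i k)).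
    by apply: linear_differentiable => z; exact: cvg_fst.
  exact: differentiable_coord.
apply: (@differentiable_comp _ _ _ _ snd (fun A : 'M[R]_(n, p) => A k j)).
  by apply: linear_differentiable => z; exact: cvg_snd.
exact: differentiable_coord.
Qed.

Section Mulmx.
Variables (V : normedModType R) (m n p : nat).
Variables (A : V -> 'M[R]_(m, n)) (B : V -> 'M[R]_(n, p)) (x : V).
Hypotheses (dA : differentiable A x) (dB : differentiable B x).

Lemma differentiable_mulmx : differentiable (fun y => A y *m B y) x.
Proof.
by have [] := derivative_bilinear x (@mulmx_continuous m n p) dA dB.
Qed.

Lemma derive_mulmx v :
  'D_v (fun y => A y *m B y) x = 'D_v A x *m B x + A x *m 'D_v B x.
Proof.
by have [] := derivative_bilinear v (@mulmx_continuous m n p) dA dB.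
Qed.

End Mulmx.

End Calculus.

(** * Closure properties of the classes [Ck] *)

Section CkCalculus.
Variable R : realType.
Implicit Types U V W : normedModType R.

(** The difference [g - f] vanishes near [x], so the null map is its differential; [g] is the sum of
    [f] and this difference. *)
Lemma near_eq_differentiable V W (f g : V -> W) (x : V) :
  (\forall y \near x, f y = g y) -> differentiable f x -> differentiable g x.
Proof.
move=> fg df; pose h y := g y - f y.
have h0 : \forall y \near x, h y = 0.
  by apply: filterS fg => y fgy; rewrite /h fgy subrr.
have hx : h x = 0 by exact: nbhs_singleton h0.
have hE : h \o shift x = cst (h x) + \0 +o_ 0 id.
  apply/eqaddoP => e e0; near=> y.
  have hy : h (y + x) = 0.
    near: y; move: h0; rewrite (near_shift 0); apply: filterS => y /=.
    by rewrite subr0.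
  by rewrite !fctE /= hx hy addr0 subrr normr0 mulr_ge0 ?(ltW e0).
have [c0 _] := dcst (0 : W) x.
have dh : differentiable h x.
  by apply/diff_locallyP; rewrite (diff_unique c0 hE).
rewrite (_ : g = f + h); first exact: differentiableD.
by apply/funext => y; rewrite !fctE /h addrC subrK.
Unshelve. all: by end_near.
Qed.

(** Formulas for derivatives are available on [S] only, while [Ck] speaks of the global function
    ['D_v f]; this lemma lets the inductions below replace one by the other. Openness turns
    agreement on [S] into agreement near each of its points. *)
Lemma Ck_ext V W k (S : set V) (f g : V -> W) : open S ->
  (forall x, S x -> f x = g x) -> Ck k S f -> Ck k S g.
Proof.
move=> oS; elim: k f g => [|k IH] f g fg /=.
  move=> cf x Sx; have nfg : \forall y \near x, f y = g y.
    by apply: filterS (open_nbhs_nbhs (conj oS Sx)) => y; exact: fg.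
  rewrite /prop_for /continuous_at -(fg x Sx).
  by apply: cvg_trans (cf x Sx); exact: near_eq_cvg.
move=> [df cf]; split=> [x Sx|v].
  have nfg : \forall y \near x, f y = g y.
    by apply: filterS (open_nbhs_nbhs (conj oS Sx)) => y; exact: fg.
  exact: near_eq_differentiable nfg (df x Sx).
apply: IH (cf v) => x Sx; apply: near_eq_derive.
by apply: filterS (open_nbhs_nbhs (conj oS Sx)) => y; exact: fg.
Qed.

Lemma Ck_continuous V W k (S : set V) (f : V -> W) x :
  Ck k S f -> S x -> {for x, continuous f}.
Proof.
case: k => [|k] /= H Sx; first exact: H.
exact/differentiable_continuous/H.1.
Qed.

Lemma Ck_differentiable V W k (S : set V) (f : V -> W) x :
  Ck k.+1 S f -> S x -> differentiable f x.
Proof. by case=> H _; exact: H. Qed.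

Lemma Ck_derive V W k (S : set V) (f : V -> W) v :
  Ck k.+1 S f -> Ck k S ('D_v f).
Proof. by case=> _; exact. Qed.

Lemma Ck_lower V W k (S : set V) (f : V -> W) : Ck k.+1 S f -> Ck k S f.
Proof.
elim: k f => [|k IH] f H; first by rewrite /= => x Sx; exact: (Ck_continuous H).
by split=> [x Sx|v]; [exact: Ck_differentiable H Sx|apply/IH/(Ck_derive v H)].
Qed.

Lemma Ck_subset V W k (S T : set V) (f : V -> W) :
  T `<=` S -> Ck k S f -> Ck k T f.
Proof.
move=> TS; elim: k f => [|k IH] f /=; first by move=> cf x /TS; exact: cf.
by move=> [df cf]; split=> [x /TS|v]; [exact: df|apply: IH].
Qed.

Lemma Ck_cst V W k (S : set V) (a : W) : Ck k S (fun=> a).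
Proof.
elim: k a => [|k IH] a /=; first by move=> x _; exact: cst_continuous.
split=> [x _|v]; first exact: differentiable_cst.
by rewrite (_ : 'D_v _ = fun=> 0) //; apply/funext => x; rewrite derive_cst.
Qed.

Lemma Ck_add V W k (S : set V) (f g : V -> W) : open S ->
  Ck k S f -> Ck k S g -> Ck k S (fun x => f x + g x).
Proof.
move=> oS; elim: k f g => [|k IH] f g.
  by move=> cf cg x Sx; apply: cvgD; [exact: cf|exact: cg].
move=> [df cf] [dg cg]; split=> [x Sx|v].
  by apply: differentiableD; [exact: df|exact: dg].
apply: Ck_ext (IH _ _ (cf v) (cg v)) => // x Sx.
by rewrite -deriveD //; apply: diff_derivable; [exact: df|exact: dg].
Qed.

Lemma Ck_bilinear U V W W' k (S : set U) (f : {bilinear V -> W -> W'})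
    (A : U -> V) (B : U -> W) : open S -> continuous (fun p => f p.1 p.2) ->
  Ck k S A -> Ck k S B -> Ck k S (fun x => f (A x) (B x)).
Proof.
move=> oS cf; elim: k A B => [|k IH] A B.
  move=> cA cB x Sx.
  apply: (@continuous_comp _ _ _ (fun y => (A y, B y)) (fun p => f p.1 p.2)).
    by apply: cvg_pair; [exact: cA|exact: cB].
  exact: cf.
move=> CA CB; have [dA cA] := CA; have [dB cB] := CB; split=> [x Sx|v].
  by have [] := derivative_bilinear x cf (dA x Sx) (dB x Sx).
apply: Ck_ext (Ck_add _ (IH _ _ (cA v) (Ck_lower CB))
                        (IH _ _ (Ck_lower CA) (cB v))) => // x Sx.
by have [_ ->] := derivative_bilinear v cf (dA x Sx) (dB x Sx).
Qed.

Lemma Ck_mulmx V m n p k (S : set V)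
    (A : V -> 'M[R]_(m, n)) (B : V -> 'M[R]_(n, p)) : open S ->
  Ck k S A -> Ck k S B -> Ck k S (fun x => A x *m B x).
Proof. by move=> oS; apply: Ck_bilinear => //; exact: mulmx_continuous. Qed.

Lemma Ck_mulr V k (S : set V) (a b : V -> R) : open S ->
  Ck k S a -> Ck k S b -> Ck k S (fun x => a x * b x).
Proof. by move=> oS; apply: Ck_bilinear => // p; exact: mul_continuous. Qed.

Lemma Ck_linear V W W' k (S : set V) (f : V -> W) (L : {linear W -> W'}) :
  open S -> continuous L -> Ck k S f -> Ck k S (fun x => L (f x)).
Proof.
move=> oS cL; elim: k f => [|k IH] f.
  move=> cf x Sx; apply: continuous_comp; [exact: cf|exact: cL].
move=> [df cf]; split=> [x Sx|v].
  by have [] := derivative_linear x cL (df x Sx).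
apply: Ck_ext (IH _ (cf v)) => // x Sx.
by have [_ ->] := derivative_linear v cL (df x Sx).
Qed.

Lemma Ck_mx_entry V m n k (S : set V) (f : V -> 'M[R]_(m, n)) i j :
  open S -> Ck k S f -> Ck k S (fun x => f x i j).
Proof.
move=> oS Cf; pose L := fun A : 'M[R]_(m, n) => A i j.
have linL : linear L by move=> a A B; rewrite /L !mxE.
pose LM := GRing.isLinear.Build _ _ _ _ _ linL.
pose LL : {linear _ -> _} := HB.pack L LM.
by apply: (Ck_linear (L := LL)) => //; exact: linear_mx_continuous.
Qed.

Lemma Ck_id V k (S : set V) : Ck k S (@id V).
Proof.
case: k => [|k]; first by move=> x _.
split=> [x _|v]; first by apply: ex_diff.
rewrite (_ : 'D_v _ = fun=> v); first exact: Ck_cst.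
by apply/funext => x; rewrite derive_id.
Qed.

(** The induction closes because a directional derivative of the composite is a composite with the
    same affine map: along [v] it is ['D_(L v) f] at [a + L x]. *)
Lemma Ck_comp_affine V V' W k (S : set V') (f : V' -> W) (L : {linear V -> V'})
    (a : V') : open S -> continuous L ->
  Ck k S f -> Ck k [set x | S (a + L x)] (fun x => f (a + L x)).
Proof.
move=> oS cL.
have dA x : differentiable (fun y => a + L y) x.
  apply: (@differentiableD _ _ _ (cst a) L); first exact: differentiable_cst.
  exact: linear_differentiable.
have DA x v : 'D_v (fun y => a + L y) x = L v.
  rewrite (deriveE _ (dA x)).
  rewrite (@diffD _ _ _ (cst a) L) ?diff_cst ?diff_lin //= ?add0r //.
  exact: linear_differentiable.
elim: k f => [|k IH] f.
  move=> cf x Sx; apply: (@continuous_comp _ _ _ (fun y => a + L y) f).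
    exact/differentiable_continuous/dA.
  exact: cf.
move=> [df cf]; split=> [x Sx|v].
  by apply: (@differentiable_comp _ _ _ _ (fun y => a + L y) f) => //; exact: df.
have oS' : open [set x | S (a + L x)].
  by apply: open_comp oS => x _; exact/differentiable_continuous/dA.
apply: Ck_ext (IH _ (cf (L v))) => // x Sx.
by rewrite (@derive_comp _ _ _ _ (fun y => a + L y) f _ _ (dA x)) ?DA //; exact: df.
Qed.

(** The derivative - a^-1 a^-1 a' is a product of functions already known to be C^k, by induction
    for the inverse itself. *)
Lemma Ck_inv V k (S : set V) (a : V -> R) : open S ->
  (forall x, S x -> a x != 0) -> Ck k S a -> Ck k S (fun x => (a x)^-1).
Proof.
move=> oS a0; elim: k => [|k IH] Ca.
  by move=> x Sx; apply: continuousV; [exact: a0|exact: Ca].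
have [da ca] := Ca; split=> [x Sx|v].
  by apply: differentiableV; [exact: da|exact: a0].
have Ci := IH (Ck_lower Ca).
have C := Ck_mulr oS (Ck_mulr oS Ci Ci) (Ck_mulr oS (Ck_cst k S (-1 : R)) (ca v)).
apply: Ck_ext C => // x Sx.
rewrite /= deriveV ?a0 //; last by apply: diff_derivable; exact: da.
by rewrite /GRing.scale /= mulN1r -exprVn expr2 mulrN mulNr.
Qed.

(** The derivative is a' / (2 sqrt a), so the induction hypothesis on the square root combines with
    [Ck_inv]. *)
Lemma Ck_sqrt V k (S : set V) (a : V -> R) : open S ->
  (forall x, S x -> 0 < a x) -> Ck k S a -> Ck k S (fun x => Num.sqrt (a x)).
Proof.
move=> oS a0; elim: k => [|k IH] Ca.
  by move=> x Sx; apply: continuous_comp; [exact: Ca|exact: sqrt_continuous].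
have [da ca] := Ca.
have ds x : S x -> differentiable (@Num.sqrt R) (a x).
  by move=> /a0 ax; apply/derivable1_diffP; have [] := is_derive1_sqrt ax.
split=> [x Sx|v].
  by apply: (differentiable_comp (da x Sx)); exact: ds.
have Cs := IH (Ck_lower Ca).
have s0 x : S x -> 2 * Num.sqrt (a x) != 0.
  by move=> Sx; rewrite mulf_neq0 ?pnatr_eq0 // gt_eqF // sqrtr_gt0 a0.
have C := Ck_mulr oS (Ck_inv oS s0 (Ck_mulr oS (Ck_cst k S (2 : R)) Cs)) (ca v).
apply: Ck_ext C => // x Sx.
rewrite (derive_comp v (da x Sx) (ds x Sx)).
rewrite (deriveE _ (ds x Sx)) deriv1E; last by have [] := is_derive1_sqrt (a0 x Sx).
by rewrite derive1E derive_sqrt ?a0 // [RHS]mulrC.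
Qed.

End CkCalculus.

(** * Symmetry of second derivatives *)

Section SecondDerivatives.
Variable R : realType.
Variable V : normedModType R.
Implicit Types (u v x p : V).

Lemma derive_along_line (f : V -> R) p v (s : R) :
  differentiable f (p + s *: v) ->
  is_derive s 1 (fun r : R => f (p + r *: v)) ('D_v f (p + s *: v)).
Proof.
move=> df; pose A (r : R) := p + r *: v.
have dv : differentiable (fun r : R => r *: v) s.
  exact/differentiableZl/ex_diff.
have dA : differentiable A s.
  by apply: (@differentiableD _ _ _ (cst p)) => //; exact: differentiable_cst.
have DA : 'D_1 A s = v.
  have dp : differentiable (cst p : R -> V) s by exact: differentiable_cst.
  rewrite (deriveE _ dA) (diffD dp dv) diff_cst /= add0r.
  have did : differentiable (@id R) s by exact: ex_diff.
  by rewrite (diffZl v did) diff_val scale1r.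
apply: DeriveDef; first by apply: diff_derivable; exact: differentiable_comp.
by rewrite (derive_comp (1 : R) dA df) DA.
Qed.

Lemma mean_value_line (f : V -> R) p v (e : R) : 0 < e ->
  (forall s, 0 <= s <= e -> differentiable f (p + s *: v)) ->
  exists2 s, 0 <= s <= e & f (p + e *: v) - f p = e * 'D_v f (p + s *: v).
Proof.
move=> e0 df; pose g (r : R) := f (p + r *: v).
have dg s : 0 <= s <= e -> is_derive s 1 g ('D_v f (p + s *: v)).
  by move=> /df; exact: derive_along_line.
have cg : {within `[0, e], continuous g}.
  apply: derivable_within_continuous => s; rewrite in_itv /= => /dg d.
  by have [] := d.
have [s|s] := @MVT R g (fun s => 'D_v f (p + s *: v)) 0 e e0 _ cg.
  by rewrite in_itv /= => /andP[s0 se]; apply: dg; rewrite !ltW.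
rewrite in_itv /= => /andP[s0 se]; rewrite /g scale0r addr0 subr0 => gE.
by exists s; [rewrite !ltW|rewrite gE mulrC].
Qed.

(** The mean value theorem is used twice: along [u] for the difference of [f] in the direction [v],
    then along [v] for ['D_u f]. *)
Lemma second_difference (S : set V) (f : V -> R) x u v (e : R) : 0 < e ->
  (forall a b, 0 <= a <= e -> 0 <= b <= e -> S (x + a *: u + b *: v)) ->
  Ck 2 S f ->
  exists2 ab : R * R, (0 <= ab.1 <= e) && (0 <= ab.2 <= e) &
    f (x + e *: u + e *: v) - f (x + e *: u) - f (x + e *: v) + f x =
    e * e * 'D_v ('D_u f) (x + ab.1 *: u + ab.2 *: v).
Proof.
move=> e0 Sx Cf; have eb : 0 <= e <= e by rewrite lexx ltW.
have zb : 0 <= (0 : R) <= e by rewrite lexx ltW.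
have df y : S y -> differentiable f y by exact: (Ck_differentiable Cf).
have ddf y : S y -> differentiable ('D_u f) y.
  exact: (Ck_differentiable (Ck_derive u Cf)).
have Sx0 a : 0 <= a <= e -> S (x + a *: u).
  by move=> ae; have := Sx a 0 ae zb; rewrite scale0r addr0.
pose G p := f (p + e *: v) - f p.
have dG a : 0 <= a <= e -> differentiable (f \o shift (e *: v)) (x + a *: u).
  move=> ae; apply: differentiable_comp; last exact/df/Sx.
  apply: (@differentiableD _ _ _ id (cst (e *: v))); first exact: ex_diff.
  exact: differentiable_cst.
have [a ae Ga] : exists2 a, 0 <= a <= e &
    G (x + e *: u) - G x = e * 'D_u G (x + a *: u).
  apply: mean_value_line => // a ae; apply: differentiableB; first exact: dG.
  exact/df/Sx0.
have [b be Gb] := @mean_value_line ('D_u f) (x + a *: u) v e e0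
  (fun b be => ddf _ (Sx a b ae be)).
exists (a, b) => /=; first by rewrite ae be.
rewrite -mulrA -Gb.
have -> : f (x + e *: u + e *: v) - f (x + e *: u) - f (x + e *: v) + f x =
  G (x + e *: u) - G x by rewrite /G; ring.
rewrite Ga; congr (_ * _).
rewrite [G](_ : _ = (f \o shift (e *: v)) - f); last exact/funext.
rewrite deriveB; first last.
- exact/diff_derivable/df/Sx0.
- exact/diff_derivable/dG.
congr (_ - _).
(* Differentiation commutes with the shift of the argument: both difference quotients are the same
   function of the increment. *)
rewrite /derive; set F := (F in lim (F @ _)); set H := (H in _ = lim (H @ _)).
suff -> : F = H by [].
by apply/funext => h; rewrite /F /H /= -(addrA _ (x + a *: u)).
Qed.

(** Schwarz theorem. The second difference is unchanged when [u] and [v] are exchanged, so the two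
    mixed derivatives share a value at points arbitrarily close to [x], and continuity concludes. *)
Lemma derive_sym (S : set V) (f : V -> R) x u v : open S -> S x -> Ck 2 S f ->
  'D_u ('D_v f) x = 'D_v ('D_u f) x.
Proof.
move=> oS Sx Cf; apply/eqP; apply/negPn/negP => /eqP ne.
set A := 'D_u ('D_v f) in ne *; set B := 'D_v ('D_u f) in ne *.
have cA : {for x, continuous A}.
  exact: (Ck_continuous (Ck_derive u (Ck_derive v Cf)) Sx).
have cB : {for x, continuous B}.
  exact: (Ck_continuous (Ck_derive v (Ck_derive u Cf)) Sx).
(* Half of the supposed gap: if [A] and [B] stay within [d] of their values at [x], a common value
   is contradictory. *)
pose d := `|A x - B x| / 2.
have d0 : 0 < d.
  by apply: divr_gt0; [rewrite normr_gt0 subr_eq0; apply/eqP|exact: ltr0n].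
clear ne.
have P : \forall y \near x, [/\ S y, `|A x - A y| < d & `|B x - B y| < d].
  have nS : \forall y \near x, S y by exact: (open_nbhs_nbhs (conj oS Sx)).
  have nA : \forall y \near x, `|A x - A y| < d by move/cvgrPdist_lt: cA; apply.
  have nB : \forall y \near x, `|B x - B y| < d by move/cvgrPdist_lt: cB; apply.
  by apply: filterS3 nS nA nB => y Sy Ay By; split.
pose L (ab : R * R) := x + ab.1 *: u + ab.2 *: v.
have cL : {for (0, 0), continuous L}.
  apply: cvgD; last by apply: cvgZr_tmp; exact: cvg_snd.
  apply: cvgD; first exact: cvg_cst.
  by apply: cvgZr_tmp; exact: cvg_fst.
have L0 : L (0, 0) = x by rewrite /L !scale0r !addr0.
have {}P : \forall ab \near ((0, 0) : R * R),
    [/\ S (L ab), `|A x - A (L ab)| < d & `|B x - B (L ab)| < d].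
  have PL : \forall y \near L (0, 0), [/\ S y, `|A x - A y| < d & `|B x - B y| < d].
    by rewrite L0.
  exact: (cL _ PL).
have [r /= r0 rP] := (nbhs_ballP _ _).1 P.
(* Half of the radius, so that the closed square of side [e] lies in the open ball. *)
pose e := r / 2.
have e0 : 0 < e by rewrite divr_gt0.
have Q a b : 0 <= a <= e -> 0 <= b <= e ->
    [/\ S (L (a, b)), `|A x - A (L (a, b))| < d & `|B x - B (L (a, b))| < d].
  have er c : 0 <= c <= e -> ball (0 : R) r c.
    move=> /andP[c0 ce]; rewrite -ball_normE /= sub0r normrN (ger0_norm c0).
    by apply: (le_lt_trans ce); rewrite ltr_pdivrMr // ltr_pMr // ltr1n.
  by move=> ae be; apply: rP; split; exact: er.
have [[a b] /= /andP[ae be] E1] := @second_difference S f x u v e e0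
  (fun a b ae be => let: And3 s _ _ := Q a b ae be in s) Cf.
have [[b' a'] /= /andP[be' ae'] E2] : exists2 ab : R * R,
    (0 <= ab.1 <= e) && (0 <= ab.2 <= e) &
    f (x + e *: v + e *: u) - f (x + e *: v) - f (x + e *: u) + f x =
    e * e * 'D_u ('D_v f) (x + ab.1 *: v + ab.2 *: u).
  apply: (@second_difference S) => // b' a' be' ae'.
  by have [+ _ _] := Q _ _ ae' be'; rewrite /L /= addrAC.
have EAB : A (L (a', b')) = B (L (a, b)).
  apply: (@mulfI _ (e * e)); first by rewrite mulf_neq0 // gt_eqF.
  rewrite /L /= (addrAC x (a' *: u)) -E2 -E1 (addrAC x (e *: v)); ring.
have [_ hA _] := Q _ _ ae' be'.
have [_ _ hB] := Q _ _ ae be.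
have H (p q r' s d' : R) : `|p - r'| < d' -> `|q - s| < d' -> r' = s ->
    `|p - q| < d' + d'.
  move=> h1 h2 rs; rewrite (_ : p - q = (p - r') - (q - s)); last by rewrite rs; ring.
  by apply: (le_lt_trans (ler_normB _ _)); exact: ltrD.
have := H _ _ _ _ _ hA hB EAB.
by rewrite -splitr ltxx.
Qed.

Lemma derive_sym_mx (S : set V) m n (f : V -> 'M[R]_(m, n)) x u v :
  open S -> S x -> Ck 2 S f -> 'D_u ('D_v f) x = 'D_v ('D_u f) x.
Proof.
move=> oS Sx Cf; apply/matrixP => i j.
have dd w : differentiable ('D_w f) x.
  exact: (Ck_differentiable (Ck_derive w Cf)).
apply: (etrans (esym (derive_entry u i j (dd v)))).
apply: etrans (derive_entry v i j (dd u)).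
pose fij y := f y i j.
have Cfij : Ck 2 S fij by exact: Ck_mx_entry.
have E w : {near x, (fun y => 'D_w f y i j) =1 'D_w fij}.
  apply: filterS (open_nbhs_nbhs (conj oS Sx)) => y Sy.
  by rewrite (derive_entry _ _ _ (Ck_differentiable Cf Sy)).
refine (etrans (near_eq_derive u (E v)) (etrans _ (esym (near_eq_derive v (E u))))).
exact: (derive_sym u v oS Sx Cfij).
Qed.

End SecondDerivatives.

(** * Levi-Civita connections and Euler-Lagrange covectors *)

Section Bil.
Variable R : realType.

Section Algebra.
Variable n : nat.
Implicit Types (A B : 'M[R]_n) (v w : 'rV[R]_n).

Lemma bilDm A B v w : bil (A + B) v w = bil A v w + bil B v w.
Proof. by rewrite /bil mulmxDr mulmxDl mxE. Qed.

Lemma bilDl A v v' w : bil A (v + v') w = bil A v w + bil A v' w.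
Proof. by rewrite /bil !mulmxDl mxE. Qed.

Lemma bilDr A v w w' : bil A v (w + w') = bil A v w + bil A v w'.
Proof. by rewrite /bil linearD mulmxDr mxE. Qed.

Lemma bilZl A a v w : bil A (a *: v) w = a * bil A v w.
Proof. by rewrite /bil -!scalemxAl mxE. Qed.

Lemma bilZr A a v w : bil A v (a *: w) = a * bil A v w.
Proof. by rewrite /bil linearZ -scalemxAr mxE. Qed.

Lemma bilNl A v w : bil A (- v) w = - bil A v w.
Proof. by rewrite -scaleN1r bilZl mulN1r. Qed.

Lemma bilNr A v w : bil A v (- w) = - bil A v w.
Proof. by rewrite -scaleN1r bilZr mulN1r. Qed.

Lemma bil0l A w : bil A 0 w = 0.
Proof. by rewrite /bil !mul0mx mxE. Qed.

Lemma bil0r A v : bil A v 0 = 0.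
Proof. by rewrite /bil trmx0 mulmx0 mxE. Qed.

Lemma bil0m v w : bil (0 : 'M[R]_n) v w = 0.
Proof. by rewrite /bil mulmx0 mul0mx mxE. Qed.

Lemma bil_mulmxl A B v w : bil A (v *m B) w = bil (B *m A) v w.
Proof. by rewrite /bil !mulmxA. Qed.

Lemma bil_mulmxr A B v w : bil A v (w *m B) = bil (A *m B^T) v w.
Proof. by rewrite /bil trmx_mul !mulmxA. Qed.

Lemma bil_tr A v w : bil A^T v w = bil A w v.
Proof.
rewrite /bil -[in RHS](trmxK (w *m A *m v^T)) [RHS]mxE.
by rewrite [in RHS]trmx_mul [in RHS]trmx_mul trmxK mulmxA.
Qed.

Lemma bil_sym A v w : A^T = A -> bil A v w = bil A w v.
Proof. by move=> As; rewrite -bil_tr As. Qed.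

Lemma bil_eq0l A v : (forall w, bil A v w = 0) -> v *m A = 0.
Proof.
move=> H; apply/rowP => j; have := H (delta_mx 0 j).
by rewrite /bil trmx_delta -colE !mxE.
Qed.

Lemma bil_unit_eq0 A v : A \in unitmx -> (forall w, bil A v w = 0) -> v = 0.
Proof. by move=> Au /bil_eq0l vA; rewrite -(mulmxK Au v) vA mul0mx. Qed.

End Algebra.

Lemma bil_pull n k (J : 'M[R]_(k, n)) (A : 'M[R]_n) (v w : 'rV[R]_k) :
  bil (J *m A *m J^T) v w = bil A (v *m J) (w *m J).
Proof. by rewrite /bil trmx_mul !mulmxA. Qed.

Lemma trmx_congruence n k (J : 'M[R]_(k, n)) (A : 'M[R]_n) :
  A^T = A -> (J *m A *m J^T)^T = J *m A *m J^T.
Proof. by move=> As; rewrite !trmx_mul trmxK As mulmxA. Qed.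

Lemma trmx_differentiable (V : normedModType R) m n (f : V -> 'M[R]_(m, n)) x :
  differentiable f x -> differentiable (fun y => (f y)^T) x.
Proof.
move=> df; have [] // := derivative_linear (L := @trmx R m n) x _ df.
exact: linear_mx_continuous.
Qed.

Lemma trmx_derive (V : normedModType R) m n (f : V -> 'M[R]_(m, n)) x v :
  differentiable f x -> 'D_v (fun y => (f y)^T) x = ('D_v f x)^T.
Proof.
move=> df; have [] // := derivative_linear (L := @trmx R m n) v _ df.
exact: linear_mx_continuous.
Qed.

Section Derivative.
Variables (V : normedModType R) (n : nat).
Variables (A : V -> 'M[R]_n) (X Y : V -> 'rV[R]_n) (x : V).
Hypotheses (dA : differentiable A x) (dX : differentiable X x)
  (dY : differentiable Y x).

Let dM : differentiable (fun y => X y *m A y *m (Y y)^T) x.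
Proof.
by apply: differentiable_mulmx; [exact: differentiable_mulmx|exact: trmx_differentiable].
Qed.

Lemma differentiable_bil : differentiable (fun y => bil (A y) (X y) (Y y)) x.
Proof. exact: differentiable_entry dM. Qed.

Lemma derive_bil v : 'D_v (fun y => bil (A y) (X y) (Y y)) x =
  bil ('D_v A x) (X x) (Y x) + bil (A x) ('D_v X x) (Y x)
  + bil (A x) (X x) ('D_v Y x).
Proof.
rewrite (derive_entry v 0 0 dM) derive_mulmx ?trmx_derive //; last first.
- exact: trmx_differentiable.
- exact: differentiable_mulmx.
rewrite derive_mulmx // mulmxDl [LHS]mxE [X in X + _]mxE.
by rewrite [bil ('D_v A x) _ _ + _]addrC.
Qed.

End Derivative.
End Bil.

Lemma derive_sum_coord (R : realType) k (W : normedModType R)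
    (f : 'rV[R]_k -> W) y (v : 'rV[R]_k) : differentiable f y ->
  'D_v f y = \sum_i v 0 i *: 'D_(delta_mx 0 i) f y.
Proof.
move=> df; rewrite (deriveE _ df) {1}(row_sum_delta v) linear_sum.
by apply: eq_bigr => i _; rewrite linearZ (deriveE _ df).
Qed.

(** The connection matrix of the coordinate direction [i]: it acts on the field being
    differentiated, whereas [conn_mx] freezes the field and acts on the direction. *)
Definition christoffel_mx (R : realType) n (G : 'rV[R]_n -> 'M[R]_n) x i :=
  \matrix_(j, k) christoffel G x i j k.

Section Metric.
Variables (R : realType) (n : nat) (G : 'rV[R]_n -> 'M[R]_n) (x : 'rV[R]_n).
Hypotheses (dG : differentiable G x) (uG : G x \in unitmx)
  (sG : \forall y \near x, (G y)^T = G y).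
Implicit Types a b w : 'rV[R]_n.

Let sGx : (G x)^T = G x. Proof. exact: nbhs_singleton sG. Qed.

Local Notation Gam := (christoffel_mx G x).

Lemma conn_mxE a b : a *m conn_mx G x b = \sum_i a 0 i *: (b *m Gam i).
Proof.
apply/rowP => k; rewrite mxE summxE; apply: eq_bigr => i _.
by rewrite !mxE; congr (_ * _); apply: eq_bigr => j _; rewrite !mxE mulrC.
Qed.

Lemma conn_sym a b : a *m conn_mx G x b = b *m conn_mx G x a.
Proof.
(* Taking the symbols themselves for [C] turns the characterisation into torsion-freeness and metric
   compatibility. *)
have [+ _] := christoffel_levi_civita (christoffel G x) uG sG.
move=> /(_ (fun _ _ _ => erefl)) [tors _].
apply/rowP => k; rewrite !mxE.
under eq_bigr do rewrite mxE mulr_sumr.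
rewrite exchange_big /=; apply: eq_bigr => i _; rewrite mxE mulr_sumr.
by apply: eq_bigr => j _; rewrite tors; ring.
Qed.

Lemma conn_metric a b w : bil ('D_a G x) b w =
  bil (G x) (a *m conn_mx G x b) w + bil (G x) b (a *m conn_mx G x w).
Proof.
have [+ _] := christoffel_levi_civita (christoffel G x) uG sG.
move=> /(_ (fun _ _ _ => erefl)) [_ metr].
have DiG i : 'D_(delta_mx 0 i) G x = Gam i *m G x + G x *m (Gam i)^T.
  apply/matrixP => j k; rewrite -(derive_entry _ _ _ dG) [LHS]metr !mxE.
  congr (_ + _); apply: eq_bigr => l _; rewrite !mxE //.
  by rewrite mulrC.
rewrite (derive_sum_coord a dG) !conn_mxE.
have bsum m (F : 'I_m -> 'M[R]_n) : bil (\sum_i F i) b w = \sum_i bil (F i) b w.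
  by rewrite /bil mulmx_sumr mulmx_suml summxE.
have lsum m (F : 'I_m -> 'rV[R]_n) :
    bil (G x) (\sum_i F i) w = \sum_i bil (G x) (F i) w.
  by rewrite /bil !mulmx_suml summxE.
have rsum m (F : 'I_m -> 'rV[R]_n) :
    bil (G x) b (\sum_i F i) = \sum_i bil (G x) b (F i).
  by rewrite /bil linear_sum mulmx_sumr summxE.
rewrite bsum lsum rsum -big_split /=; apply: eq_bigr => i _.
rewrite bilZl bilZr -mulrDr DiG bil_mulmxl bil_mulmxr -bilDm.
by rewrite /bil -scalemxAr -scalemxAl mxE.
Qed.

(** The Koszul formula for fields with constant components, whose brackets vanish. *)
Lemma koszul a b w : 2 * bil (G x) (a *m conn_mx G x b) w =
  bil ('D_a G x) b w + bil ('D_b G x) a w - bil ('D_w G x) a b.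
Proof.
rewrite !conn_metric (conn_sym b a) (conn_sym w a) (conn_sym w b).
rewrite [bil _ (a *m conn_mx G x w) _](bil_sym _ _ sGx).
by ring.
Qed.

End Metric.

(** The covector d/dt dL/dv - dL/dx of the energy L(x, v) = G_x(v, v) / 2, paired with [w]. *)
Definition euler_lagrange (R : realType) n (G : 'rV[R]_n -> 'M[R]_n)
    (c : R -> 'rV[R]_n) (t : R) (w : 'rV[R]_n) : R :=
  'D_1 (fun s => bil (G (c s)) (derive1 c s) w) t
  - 2^-1 * bil ('D_w G (c t)) (derive1 c t) (derive1 c t).

Section EulerLagrange.
Variables (R : realType) (n : nat) (G : 'rV[R]_n -> 'M[R]_n).
Variables (c : R -> 'rV[R]_n) (t : R).
Hypotheses (dc : differentiable c t) (dG : differentiable G (c t)).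

Lemma derive_comp_curve (W : normedModType R) (f : 'rV[R]_n -> W) :
  differentiable f (c t) ->
  'D_1 (fun s => f (c s)) t = 'D_(derive1 c t) f (c t).
Proof. by move=> df; rewrite (derive_comp (1 : R) dc df) derive1E. Qed.

Lemma euler_lagrangeE w : differentiable (derive1 c) t ->
  euler_lagrange G c t w =
  bil ('D_(derive1 c t) G (c t)) (derive1 c t) w
  + bil (G (c t)) ('D_1 (derive1 c) t) w
  - 2^-1 * bil ('D_w G (c t)) (derive1 c t) (derive1 c t).
Proof.
move=> ddc; have dw : differentiable (cst w : R -> 'rV[R]_n) t.
  exact: differentiable_cst.
rewrite /euler_lagrange (derive_bil _ ddc dw); last exact: (differentiable_comp dc dG).
by rewrite derive_comp_curve // derive_cst bil0r addr0.
Qed.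

(** The Koszul formula with both fields equal to the velocity: the covector is the acceleration with
    its index lowered. *)
Lemma euler_lagrange_cov w : differentiable (derive1 c) t ->
  G (c t) \in unitmx -> (\forall y \near c t, (G y)^T = G y) ->
  bil (G (c t)) (cov_along G c (derive1 c) t) w = euler_lagrange G c t w.
Proof.
move=> ddc uG sG; rewrite euler_lagrangeE // /cov_along bilDl derive1E.
apply: (@mulfI _ 2); first by rewrite pnatr_eq0.
rewrite mulrDr koszul //.
by field.
Qed.

(** The index is raised back by invertibility of [G (c t)], so the criterion covers the phi-Sasaki
    and induced metrics, which may be indefinite. *)
Lemma geodesic_euler_lagrange : differentiable (derive1 c) t ->
  G (c t) \in unitmx -> (\forall y \near c t, (G y)^T = G y) ->
  geodesic_at G c t <-> forall w, euler_lagrange G c t w = 0.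
Proof.
move=> ddc uG sG; split=> [geo w|EL].
  by rewrite -euler_lagrange_cov // geo bil0l.
by apply: (bil_unit_eq0 uG) => w; rewrite euler_lagrange_cov.
Qed.

(** Leibniz rule for a form [h] that is parallel for the connection of another metric [G]. It is
    applied with [h] equal to g and to its twin, so that both are differentiated by the same
    covariant derivative. *)
Lemma derive_bil_cov (h : 'rV[R]_n -> 'M[R]_n) (X Y : R -> 'rV[R]_n) :
  differentiable h (c t) ->
  (forall a b w, bil ('D_a h (c t)) b w =
     bil (h (c t)) (a *m conn_mx G (c t) b) w
     + bil (h (c t)) b (a *m conn_mx G (c t) w)) ->
  differentiable X t -> differentiable Y t ->
  'D_1 (fun s => bil (h (c s)) (X s) (Y s)) t =
  bil (h (c t)) (cov_along G c X t) (Y t) + bil (h (c t)) (X t) (cov_along G c Y t).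
Proof.
move=> dh compat dX dY; rewrite (derive_bil (A := fun s => h (c s))) //; last first.
  exact: (differentiable_comp dc dh).
rewrite derive_comp_curve // compat /cov_along bilDl bilDr !derive1E.
by ring.
Qed.

End EulerLagrange.

(** * Naturality of the Euler-Lagrange covector under pullback *)

Section Jacobian.
Variables (R : realType) (k d : nat) (F : 'rV[R]_k -> 'rV[R]_d).
Variable S : set 'rV[R]_k.
Hypotheses (oS : open S) (CF : Ck 2 S F).

Let dF y : S y -> differentiable F y.
Proof. exact: (Ck_differentiable CF). Qed.

Let ddF y v : S y -> differentiable ('D_v F) y.
Proof. exact: (Ck_differentiable (Ck_derive v CF)). Qed.

Lemma near_jacobianE y v : S y ->
  {near y, (fun z => v *m 'J F z) =1 'D_v F}.
Proof.
move=> Sy; apply: filterS (open_nbhs_nbhs (conj oS Sy)) => z Sz.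
by rewrite (deriveEjacobian v (dF Sz)).
Qed.

Lemma jacobian_differentiable y : S y -> differentiable (fun z => 'J F z) y.
Proof.
move=> Sy; apply: differentiable_mxP => i j.
have : \forall z \near y, 'D_(delta_mx 0 i) F z 0 j = 'J F z i j.
  apply: filterS (near_jacobianE (delta_mx 0 i) Sy) => z <-.
  by rewrite -rowE mxE.
move=> /near_eq_differentiable; apply.
exact/differentiable_entry/ddF.
Qed.

Lemma derive_jacobian y u v : S y ->
  u *m 'D_v (fun z => 'J F z) y = 'D_v ('D_u F) y.
Proof.
move=> Sy; rewrite -(near_eq_derive v (near_jacobianE u Sy)).
have du : differentiable (cst u : 'rV[R]_k -> 'rV[R]_k) y.
  exact: differentiable_cst.
by rewrite (derive_mulmx du (jacobian_differentiable Sy)) derive_cst mul0mx add0r.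
Qed.

(** Both sides are the second differential of [F] on [u] and [v]; this is where symmetry of second
    derivatives enters. *)
Lemma derive_jacobian_sym y u v : S y ->
  u *m 'D_v (fun z => 'J F z) y = v *m 'D_u (fun z => 'J F z) y.
Proof.
move=> Sy; apply: (etrans (derive_jacobian u v Sy)).
exact: (etrans (derive_sym_mx v u oS Sy CF) (esym (derive_jacobian v u Sy))).
Qed.

End Jacobian.

Section Pullback.
Variables (R : realType) (k d : nat) (F : 'rV[R]_k -> 'rV[R]_d).
Variables (S : set 'rV[R]_k) (G : 'rV[R]_d -> 'M[R]_d).
Variables (e : R -> 'rV[R]_k) (c : R -> 'rV[R]_d) (t : R).
Hypotheses (oS : open S) (CF : Ck 2 S F) (Se : S (e t)).
Hypotheses (de : \forall s \near t, differentiable e s)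
  (dde : differentiable (derive1 e) t)
  (cE : \forall s \near t, c s = F (e s))
  (dG : differentiable G (c t)) (sG : (G (c t))^T = G (c t)).

Let det : differentiable e t. Proof. exact: nbhs_singleton de. Qed.

Let ct : c t = F (e t). Proof. exact: nbhs_singleton cE. Qed.

Let dF : differentiable F (e t).
Proof. exact: (Ck_differentiable CF Se). Qed.

Let dJ : differentiable (fun z => 'J F z) (e t).
Proof. exact: (jacobian_differentiable oS CF Se). Qed.

Let dJe : differentiable (fun s => 'J F (e s)) t.
Proof. exact: (differentiable_comp det dJ). Qed.

Let dc : differentiable c t.
Proof.
apply: (@near_eq_differentiable _ _ _ (F \o e)); last exact: differentiable_comp.
by apply: filterS cE => s ->.
Qed.

Lemma derive1_pullback : \forall s \near t,
  derive1 c s = derive1 e s *m 'J F (e s).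
Proof.
have nS : \forall s \near t, S (e s).
  exact: (differentiable_continuous det (open_nbhs_nbhs (conj oS Se))).
(* Differentiating at a nearby [s] requires the equality on a neighbourhood of [s], hence the
   passage to the interior. *)
have ncE : \forall s \near t, \forall r \near s, c r = F (e r).
  exact: (nbhs_interior cE).
apply: filterS3 nS ncE de => s Ss cs des.
have dFs : differentiable F (e s) by exact: (Ck_differentiable CF Ss).
rewrite derive1E (@near_eq_derive _ _ _ c (F \o e) s 1 cs).
by rewrite (derive_comp (1 : R) des dFs) -derive1E (deriveEjacobian _ dFs).
Qed.

Let dec : differentiable (fun s => derive1 e s *m 'J F (e s)) t.
Proof. exact: differentiable_mulmx. Qed.

Lemma differentiable_pullback : differentiable (derive1 c) t.
Proof.
by apply: near_eq_differentiable dec; apply: filterS derive1_pullback => s ->.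
Qed.

Lemma induced_metric_differentiable :
  differentiable (induced_metric G F) (e t).
Proof.
apply: differentiable_mulmx; last exact: trmx_differentiable.
apply: differentiable_mulmx => //.
apply: differentiable_comp => //; by rewrite -ct.
Qed.

(** The second differential of [F] contributes once through the moving test vector
    [u *m 'J F (e s)], and twice with factor 1/2 through the derivative of the induced metric; these
    contributions cancel. *)
Lemma euler_lagrange_pullback u :
  euler_lagrange (induced_metric G F) e t u =
  euler_lagrange G c t (u *m 'J F (e t)).
Proof.
have dGF : differentiable (G \o F) (e t) by apply: differentiable_comp; rewrite -?ct.
have dGc : differentiable (fun s => G (c s)) t by exact: (differentiable_comp dc).
have duJ : differentiable (fun s => u *m 'J F (e s)) t.
  by apply: differentiable_mulmx => //; exact: differentiable_cst.
have ddc := differentiable_pullback.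
have c't := nbhs_singleton derive1_pullback.
have E : \forall s \near t,
    bil (induced_metric G F (e s)) (derive1 e s) u =
    bil (G (c s)) (derive1 c s) (u *m 'J F (e s)).
  by apply: filterS2 derive1_pullback cE => s -> ->; rewrite bil_pull.
have D1 := etrans (near_eq_derive (1 : R) E) (derive_bil dGc ddc duJ 1).
apply: (etrans (congr1 (fun z => z - _) D1)).
rewrite (euler_lagrangeE dc dG _ ddc) (derive_comp_curve dc dG).
have DuJ : 'D_1 (fun s => u *m 'J F (e s)) t =
    derive1 e t *m 'D_u (fun z => 'J F z) (e t).
  have du : differentiable (cst u : R -> 'rV[R]_k) t by exact: differentiable_cst.
  rewrite (derive_mulmx du dJe) derive_cst mul0mx add0r.
  rewrite (derive_comp (1 : R) det dJ) -derive1E.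
  exact: (derive_jacobian_sym oS CF).
(* [z] is the second differential of [F] on the velocity of [e] and [u], the term that has to
   cancel. *)
rewrite DuJ; set z := derive1 e t *m _.
have -> : bil ('D_u (induced_metric G F) (e t)) (derive1 e t) (derive1 e t) =
    bil ('D_(u *m 'J F (e t)) G (c t)) (derive1 c t) (derive1 c t)
    + 2 * bil (G (c t)) (derive1 c t) z.
  have dJG := differentiable_mulmx dJ dGF.
  have dJT := trmx_differentiable dJ.
  rewrite /induced_metric (derive_mulmx (A := fun y => 'J F y *m (G \o F) y) dJG dJT).
  rewrite (derive_mulmx dJ dGF) trmx_derive // bilDm.
  rewrite mulmxDl bilDm /= -ct c't.
  have dG' : differentiable G (F (e t)) by rewrite -ct.
  rewrite (derive_comp u dF dG') (deriveEjacobian u dF) -ct.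
  rewrite bil_pull.
  have -> : bil ('D_u (fun z0 => 'J F z0) (e t) *m G (c t) *m ('J F (e t))^T)
      (derive1 e t) (derive1 e t) = bil (G (c t)) z (derive1 e t *m 'J F (e t)).
    by rewrite /bil /z trmx_mul !mulmxA.
  have -> : bil ('J F (e t) *m G (c t) *m ('D_u (fun z0 => 'J F z0) (e t))^T)
      (derive1 e t) (derive1 e t) = bil (G (c t)) (derive1 e t *m 'J F (e t)) z.
    by rewrite /bil /z trmx_mul !mulmxA.
  by rewrite (bil_sym z _ sG); ring.
by field.
Qed.

End Pullback.

(** * Differentiability of inverse matrices and of the connection *)

Section MatrixCalculus.
Variable R : realType.

Lemma unitmx_inj n (A : 'M[R]_n) :
  (forall v : 'rV[R]_n, v *m A = 0 -> v = 0) -> A \in unitmx.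
Proof.
move=> injA; rewrite -row_free_unit -kermx_eq0; apply/eqP/row_matrixP => i.
by rewrite row0; apply: injA; rewrite -row_mul mulmx_ker row0.
Qed.

Lemma prod_differentiable (V : normedModType R) (T : Type) (r : seq T)
    (f : T -> V -> R) x : (forall i, differentiable (f i) x) ->
  differentiable (fun y => \prod_(i <- r) f i y) x.
Proof.
move=> df; elim: r => [|i r IH].
  rewrite (_ : (fun _ => _) = cst 1); first exact: differentiable_cst.
  by apply/funext => y; rewrite big_nil.
rewrite (_ : (fun _ => _) = f i * (fun y => \prod_(j <- r) f j y)).
  exact: differentiableM.
by apply/funext => y; rewrite big_cons.
Qed.

Lemma det_differentiable (V : normedModType R) n (A : V -> 'M[R]_n) x :
  differentiable A x -> differentiable (fun y => \det (A y)) x.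
Proof.
move=> dA; rewrite /determinant; apply: sum_differentiable => s.
apply: differentiableM; first exact: differentiable_cst.
by apply: prod_differentiable => i; exact: differentiable_entry.
Qed.

(** [invmx] is defined by cases; near [x] it agrees with the Cramer formula, whose entries are
    cofactors divided by the determinant. *)
Lemma invmx_differentiable (V : normedModType R) n (A : V -> 'M[R]_n) x :
  (\forall y \near x, A y \in unitmx) -> differentiable A x ->
  differentiable (fun y => invmx (A y)) x.
Proof.
move=> uA dA.
have E : \forall y \near x, (\det (A y))^-1 *: \adj (A y) = invmx (A y).
  by apply: filterS uA => y uAy; rewrite /invmx uAy.
apply: near_eq_differentiable E _; apply: differentiable_mxP => i j.
have -> : (fun y => ((\det (A y))^-1 *: \adj (A y)) i j) =
    (fun y => (\det (A y))^-1 * cofactor (A y) j i).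
  by apply/funext => y; rewrite !mxE.
apply: differentiableM.
  apply: differentiableV; first exact: det_differentiable.
  by have := nbhs_singleton uA; rewrite unitmxE unitfE.
apply: differentiableM; first exact: differentiable_cst.
apply: det_differentiable; apply: differentiable_mxP => a b.
have -> : (fun y => row' j (col' i (A y)) a b) = (fun y => A y (lift j a) (lift i b)).
  by apply/funext => y; rewrite !mxE.
exact: differentiable_entry.
Qed.

End MatrixCalculus.

Section LeviCivitaDifferentiable.
Variables (R : realType) (n : nat) (U : set 'rV[R]_n) (G : 'rV[R]_n -> 'M[R]_n).
Hypotheses (oU : open U) (CG : Ck 2 U G) (uG : forall x, U x -> G x \in unitmx).

Lemma christoffel_differentiable x i j k : U x ->
  differentiable (fun y => christoffel G y i j k) x.
Proof.
move=> Ux; have nU := open_nbhs_nbhs (conj oU Ux).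
have dpart a b c : differentiable (partial a (fun y => G y b c)) x.
  apply: (@near_eq_differentiable _ _ _ (fun y => 'D_(delta_mx 0 a) G y b c)).
    apply: filterS nU => y Uy; rewrite /partial derive_entry //.
    exact: (Ck_differentiable CG Uy).
  exact/differentiable_entry/(Ck_differentiable (Ck_derive _ CG) Ux).
apply: differentiableM; first exact: differentiable_cst.
apply: sum_differentiable => l; apply: differentiableM.
  by apply: differentiableB => //; apply: differentiableD.
apply: differentiable_entry; apply: invmx_differentiable.
  by apply: filterS nU => y /uG.
exact: (Ck_differentiable CG Ux).
Qed.

Lemma conn_mx_differentiable (V : normedModType R) (f X : V -> 'rV[R]_n) y :
  U (f y) -> differentiable f y -> differentiable X y ->
  differentiable (fun z => conn_mx G (f z) (X z)) y.
Proof.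
move=> Uf df dX; apply: differentiable_mxP => i k.
have -> : (fun z => conn_mx G (f z) (X z) i k) =
    (fun z => \sum_j christoffel G (f z) i j k * X z 0 j).
  by apply/funext => z; rewrite mxE.
apply: sum_differentiable => j; apply: differentiableM.
  have dC := christoffel_differentiable i j k Uf.
  exact: (differentiable_comp df dC).
exact: differentiable_entry.
Qed.

Lemma cov_along_differentiable (x X : R -> 'rV[R]_n) t :
  U (x t) -> differentiable x t -> differentiable X t ->
  differentiable (derive1 x) t -> differentiable (derive1 X) t ->
  differentiable (cov_along G x X) t.
Proof.
move=> Ux dx dX ddx ddX; apply: differentiableD => //.
apply: differentiable_mulmx => //; exact: conn_mx_differentiable.
Qed.

End LeviCivitaDifferentiable.

(** * The phi-Sasaki metric in a chart *)

Section SasakiChart.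
Variables (R : realType) (n : nat) (U : set 'rV[R]_n).
Variables g phi : 'rV[R]_n -> 'M[R]_n.
Hypotheses (oU : open U) (Cg : Ck 2 U g) (Cphi : Ck 1 U phi).
Hypothesis g_sym : forall x, U x -> (g x)^T = g x.
Hypothesis g_pos : forall x, U x -> forall v, v != 0 -> 0 < bil (g x) v v.
Hypothesis phi_invol : forall x, U x -> phi x *m phi x = 1%:M.
Hypothesis phi_selfadj : forall x, U x -> forall v w,
  bil (g x) (v *m phi x) w = bil (g x) v (w *m phi x).
Hypothesis phi_parallel : forall x, U x ->
  forall k a b, nabla_endo g phi x k a b = 0.
Implicit Types (x a b v : 'rV[R]_n) (z w : 'rV[R]_(n + n)).

(** The twin metric h(a, b) = g(a, phi b) of Norden geometry, which the phi-Sasaki metric induces on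
    the fibres. The transpose arises because endomorphisms act on row vectors from the right. *)
Definition twin x : 'M[R]_n := g x *m (phi x)^T.

Lemma twinE x a b : bil (twin x) a b = bil (g x) a (b *m phi x).
Proof. by rewrite bil_mulmxr. Qed.

Let nU x : U x -> \forall y \near x, U y.
Proof. by move=> Ux; exact: (open_nbhs_nbhs (conj oU Ux)). Qed.

Let dg x : U x -> differentiable g x.
Proof. exact: (Ck_differentiable Cg). Qed.

Let dphi x : U x -> differentiable phi x.
Proof. exact: (Ck_differentiable Cphi). Qed.

Let g_sym_near x : U x -> \forall y \near x, (g y)^T = g y.
Proof. by move=> /nU; apply: filterS => y /g_sym. Qed.

Lemma metric_unit x : U x -> g x \in unitmx.
Proof.
move=> Ux; apply: unitmx_inj => v vg; apply/eqP/negPn/negP => v0.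
by have := g_pos Ux v0; rewrite /bil vg mul0mx mxE ltxx.
Qed.

Lemma twin_sym x : U x -> (twin x)^T = twin x.
Proof.
move=> Ux; rewrite /twin trmx_mul trmxK g_sym //.
apply/matrixP => i j; have := phi_selfadj Ux (delta_mx 0 i) (delta_mx 0 j).
rewrite bil_mulmxl bil_mulmxr /bil !trmx_delta -!rowE -!colE.
by rewrite !mxE.
Qed.

Lemma twin_unit x : U x -> twin x \in unitmx.
Proof.
move=> Ux; rewrite unitmx_mul metric_unit // unitmx_tr.
by have [] := mulmx1_unit (phi_invol Ux).
Qed.

Lemma twin_differentiable x : U x -> differentiable twin x.
Proof.
move=> Ux; apply: differentiable_mulmx; first exact: dg.
exact/trmx_differentiable/dphi.
Qed.

(** The equation nabla phi = 0, summed over the direction [a] and evaluated on the field with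
    constant components [v]. *)
Lemma derive_parallel x a v : U x ->
  v *m 'D_a phi x =
  a *m conn_mx g x v *m phi x - a *m conn_mx g x (v *m phi x).
Proof.
move=> Ux; have Dk k : 'D_(delta_mx 0 k) phi x =
    christoffel_mx g x k *m phi x - phi x *m christoffel_mx g x k.
  apply/matrixP => i j; have := phi_parallel Ux k i j.
  rewrite /nabla_endo /partial (derive_entry _ _ _ (dphi Ux)) => /eqP.
  rewrite subr_eq0 => /eqP E; rewrite !mxE; apply/eqP.
  rewrite -subr_eq opprK; apply/eqP; etransitivity; last first.
    by apply: eq_bigr => l _; rewrite mxE.
  rewrite -E; congr (_ + _); by apply: eq_bigr => l _; rewrite mxE.
rewrite (derive_sum_coord a (dphi Ux)) !conn_mxE mulmx_sumr mulmx_suml -sumrB.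
apply: eq_bigr => k _; rewrite -scalemxAr -scalemxAl -scalerBr Dk.
by rewrite mulmxBr !mulmxA.
Qed.

(** Compatibility of g is applied to [b] and [v *m phi x], and the derivative of phi replaces
    nabla_a (phi v) by phi (nabla_a v). Thus the Levi-Civita connection of g also preserves the twin
    metric. *)
Lemma twin_compat x a b v : U x -> bil ('D_a twin x) b v =
  bil (twin x) (a *m conn_mx g x b) v + bil (twin x) b (a *m conn_mx g x v).
Proof.
move=> Ux; have dT := trmx_differentiable (dphi Ux).
rewrite /twin (derive_mulmx (dg Ux) dT) (trmx_derive _ (dphi Ux)).
rewrite bilDm -!bil_mulmxr (derive_parallel _ _ Ux).
rewrite (conn_metric (dg Ux) (metric_unit Ux) (g_sym_near Ux)).
rewrite [X in _ + X](_ : _ = bil (g x) b (a *m conn_mx g x v *m phi x)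
   - bil (g x) b (a *m conn_mx g x (v *m phi x))); first by ring.
by rewrite bilDr bilNr.
Qed.

Notation S := (sasaki g phi).

Lemma sasaki_bilE z w w' : bil (S z) w w' =
  bil (g (lsubmx z)) (w *m hor_mx R n) (w' *m hor_mx R n)
  + bil (twin (lsubmx z)) (w *m ver_mx g z) (w' *m ver_mx g z).
Proof. by rewrite /sasaki bilDm !bil_pull. Qed.

Lemma mul_hor_mx w : w *m hor_mx R n = lsubmx w.
Proof. by rewrite -{1}(hsubmxK w) mul_row_col mulmx1 mulmx0 addr0. Qed.

Lemma mul_ver_mx z w :
  w *m ver_mx g z = lsubmx w *m conn_mx g (lsubmx z) (rsubmx z) + rsubmx w.
Proof. by rewrite -{1}(hsubmxK w) mul_row_col mulmx1. Qed.

Lemma sasaki_sym z : U (lsubmx z) -> (S z)^T = S z.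
Proof.
move=> Uz; rewrite /sasaki linearD /=; congr (_ + _); apply: trmx_congruence.
  exact: g_sym.
exact: twin_sym.
Qed.

(** The horizontal and vertical subspaces are orthogonal, so testing against the two kinds of lifts
    reduces nondegeneracy to that of g and of its twin. *)
Lemma sasaki_unit z : U (lsubmx z) -> S z \in unitmx.
Proof.
move=> Uz; apply: unitmx_inj => w w0.
have {}w0 w' : bil (S z) w w' = 0 by rewrite /bil w0 mul0mx mxE.
have hw : w *m hor_mx R n = 0.
  apply: (bil_unit_eq0 (metric_unit Uz)) => a.
  rewrite -(w0 (hlift g z a)) sasaki_bilE !mul_hor_mx (mul_ver_mx z (hlift _ _ _)).
  by rewrite !row_mxKl !row_mxKr subrr bil0r addr0.
have vw : w *m ver_mx g z = 0.
  apply: (bil_unit_eq0 (twin_unit Uz)) => a.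
  rewrite -(w0 (vlift a)) sasaki_bilE hw bil0l add0r (mul_ver_mx z (vlift _)).
  by rewrite row_mxKl row_mxKr mul0mx add0r.
by rewrite (lift_decomp g z w) hw vw /hlift /vlift mul0mx oppr0 row_mx0 add0r.
Qed.

Lemma lsubmx_derive z w : 'D_w (@lsubmx R 1 n n) z = lsubmx w.
Proof.
rewrite (deriveE _ (differentiable_lsubmx z)) diff_lin //.
exact: continuous_lsubmx.
Qed.

Lemma rsubmx_derive z w : 'D_w (@rsubmx R 1 n n) z = rsubmx w.
Proof.
rewrite (deriveE _ (differentiable_rsubmx z)) diff_lin //.
exact: continuous_rsubmx.
Qed.

Lemma ver_mx_differentiable z : U (lsubmx z) -> differentiable (ver_mx g) z.
Proof.
move=> Uz; have dC : differentiable
    (fun z : 'rV[R]_(n + n) => conn_mx g (lsubmx z) (rsubmx z)) z.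
  apply: (conn_mx_differentiable oU Cg) => //; first exact: metric_unit.
    exact: differentiable_lsubmx.
  exact: differentiable_rsubmx.
apply: differentiable_mxP => i j.
case: (split_ordP i) => k ->.
  rewrite (_ : (fun _ => _) = fun z : 'rV[R]_(n + n) =>
      conn_mx g (lsubmx z) (rsubmx z) k j); first exact: differentiable_entry.
  by apply/funext => y; rewrite col_mxEu.
rewrite (_ : (fun _ => _) = cst ((1%:M : 'M[R]_n) k j)).
  exact: differentiable_cst.
by apply/funext => y; rewrite col_mxEd.
Qed.

Lemma sasaki_differentiable z : U (lsubmx z) -> differentiable S z.
Proof.
move=> Uz; have dl := @differentiable_lsubmx R 1 n n z.
have dgl : differentiable (fun z => g (lsubmx z)) z.
  exact: (differentiable_comp dl (dg Uz)).
have dtl : differentiable (fun z => twin (lsubmx z)) z.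
  exact: (differentiable_comp dl (twin_differentiable Uz)).
have dv := ver_mx_differentiable Uz.
have dc m p (A : 'M[R]_(m, p)) : differentiable (cst A : 'rV[R]_(n + n) -> _) z.
  exact: differentiable_cst.
apply: differentiableD.
  exact: (differentiable_mulmx (differentiable_mulmx (dc _ _ _) dgl) (dc _ _ _)).
exact: (differentiable_mulmx (differentiable_mulmx dv dtl) (trmx_differentiable dv)).
Qed.

Lemma sasaki_vlift z w b :
  bil (S z) w (vlift b) = bil (twin (lsubmx z)) (w *m ver_mx g z) b.
Proof.
rewrite sasaki_bilE !mul_hor_mx (mul_ver_mx z (vlift b)) row_mxKl row_mxKr.
by rewrite bil0r mul0mx !add0r.
Qed.

Definition fiber_form z : R := bil (twin (lsubmx z)) (rsubmx z) (rsubmx z).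

(* This is where [phi] being parallel makes the vertical field z |-> vlift
   (rsubmx z) normal to the level sets of [fiber_form]. *)
Lemma derive_fiber_form z w : U (lsubmx z) ->
  differentiable fiber_form z /\
  'D_w fiber_form z = 2 * bil (S z) w (vlift (rsubmx z)).
Proof.
move=> Uz; have dl := @differentiable_lsubmx R 1 n n z.
have dr := @differentiable_rsubmx R 1 n n z.
have dt := twin_differentiable Uz.
have dtl : differentiable (fun z => twin (lsubmx z)) z.
  exact: (differentiable_comp dl dt).
split; first exact: differentiable_bil.
apply: (etrans (derive_bil dtl dr dr w)).
rewrite (derive_comp w dl dt) lsubmx_derive rsubmx_derive (twin_compat _ _ _ Uz).
rewrite sasaki_vlift mul_ver_mx bilDl.
rewrite [bil _ (rsubmx z) (lsubmx w *m _)](bil_sym _ _ (twin_sym Uz)).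
rewrite [bil _ (rsubmx z) (rsubmx w)](bil_sym _ _ (twin_sym Uz)).
by ring.
Qed.

Lemma derive_mul_ver_mx z w b : U (lsubmx z) ->
  'D_(row_mx 0 b) (fun z => w *m ver_mx g z) z =
  lsubmx w *m conn_mx g (lsubmx z) b.
Proof.
(* By torsion-freeness the two arguments of the connection are exchanged, so that the fibre
   coordinate appears as a factor of a matrix product. *)
move=> Uz; pose f (z : 'rV[R]_(n + n)) :=
  rsubmx z *m conn_mx g (lsubmx z) (lsubmx w) + rsubmx w.
have dl := @differentiable_lsubmx R 1 n n z.
have dr := @differentiable_rsubmx R 1 n n z.
have E : \forall y \near z, w *m ver_mx g y = f y.
  have nUz : \forall y \near z, U (lsubmx y).
    exact: (differentiable_continuous dl (nU Uz)).
  apply: filterS nUz => y Uy.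
  by rewrite mul_ver_mx (conn_sym (metric_unit Uy) (g_sym_near Uy)).
apply: (etrans (near_eq_derive _ E)).
have dw : differentiable (cst (lsubmx w) : 'rV[R]_n -> 'rV[R]_n) (lsubmx z).
  exact: differentiable_cst.
have dC : differentiable (fun x => conn_mx g x (lsubmx w)) (lsubmx z).
  apply: (conn_mx_differentiable oU Cg) => //; exact: metric_unit.
have dCl : differentiable (fun z : 'rV[R]_(n + n) =>
  conn_mx g (lsubmx z) (lsubmx w)) z by exact: (differentiable_comp dl dC).
have dm := differentiable_mulmx dr dCl.
have dcw : differentiable (cst (rsubmx w) : 'rV[R]_(n + n) -> 'rV[R]_n) z.
  exact: differentiable_cst.
apply: (etrans (derive_add _ dm dcw)).
rewrite derive_cst addr0 (derive_mulmx dr dCl) rsubmx_derive row_mxKr.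
rewrite (derive_comp _ dl dC) lsubmx_derive row_mxKl derive0 mulmx0 addr0.
exact: (conn_sym (metric_unit Uz) (g_sym_near Uz)).
Qed.

Lemma derive_sasaki u z w : U (lsubmx z) -> bil ('D_u S z) w w =
  bil ('D_(lsubmx u) g (lsubmx z)) (lsubmx w) (lsubmx w)
  + bil ('D_(lsubmx u) twin (lsubmx z)) (w *m ver_mx g z) (w *m ver_mx g z)
  + 2 * bil (twin (lsubmx z)) ('D_u (fun z => w *m ver_mx g z) z) (w *m ver_mx g z).
Proof.
move=> Uz; have dl := @differentiable_lsubmx R 1 n n z.
have dt := twin_differentiable Uz.
have dc m (A : 'rV[R]_m) : differentiable (cst A : 'rV[R]_(n + n) -> _) z.
  exact: differentiable_cst.
have dgl : differentiable (fun z => g (lsubmx z)) z.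
  exact: (differentiable_comp dl (dg Uz)).
have dtl : differentiable (fun z => twin (lsubmx z)) z.
  exact: (differentiable_comp dl dt).
have dv : differentiable (fun z => w *m ver_mx g z) z.
  exact: (differentiable_mulmx (dc _ w) (ver_mx_differentiable Uz)).
have D1 := derive_bil (sasaki_differentiable Uz) (dc _ w) (dc _ w) u.
have D2 := derive_bil dgl (dc _ (lsubmx w)) (dc _ (lsubmx w)) u.
have D3 := derive_bil dtl dv dv u.
rewrite derive_cst bil0l bil0r !addr0 in D1.
rewrite derive_cst bil0l bil0r !addr0 (derive_comp u dl (dg Uz)) lsubmx_derive in D2.
rewrite (derive_comp u dl dt) lsubmx_derive in D3.
apply: (etrans (esym D1)).
have E : (fun y => bil (S y) (cst w y) (cst w y)) =
    (fun y => bil (g (lsubmx y)) (lsubmx w) (lsubmx w)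
      + bil (twin (lsubmx y)) (w *m ver_mx g y) (w *m ver_mx g y)).
  by apply/funext => y; rewrite /cst sasaki_bilE !mul_hor_mx.
have d2 := differentiable_bil dgl (dc _ (lsubmx w)) (dc _ (lsubmx w)).
have d3 := differentiable_bil dtl dv dv.
rewrite E; apply: (etrans (derive_add _ d2 d3)).
apply: (etrans (congr2 +%R D2 D3)).
rewrite [bil _ (w *m ver_mx g z) ('D_u _ z)](bil_sym _ _ (twin_sym Uz)).
by rewrite /cst; ring.
Qed.

Section Curve.
Variables (x X : R -> 'rV[R]_n) (t : R).
Hypotheses (dx : \forall s \near t, differentiable x s)
  (dX : \forall s \near t, differentiable X s)
  (ddx : differentiable (derive1 x) t) (ddX : differentiable (derive1 X) t)
  (Ux : U (x t)).

Let c s := row_mx (x s) (X s).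

Lemma row_mx_differentiable s : differentiable x s -> differentiable X s ->
  differentiable c s.
Proof.
move=> dxs dXs; apply: differentiable_mxP => i j.
case: (split_ordP j) => k ->.
  rewrite (_ : (fun _ => _) = fun s => x s i k); first exact: differentiable_entry.
  by apply/funext => r; rewrite row_mxEl.
rewrite (_ : (fun _ => _) = fun s => X s i k); first exact: differentiable_entry.
by apply/funext => r; rewrite row_mxEr.
Qed.

Lemma derive1_row_mx s : differentiable x s -> differentiable X s ->
  derive1 c s = row_mx (derive1 x s) (derive1 X s).
Proof.
move=> dxs dXs; have dc := row_mx_differentiable dxs dXs.
rewrite -[LHS]hsubmxK !derive1E.
have [_ Dl] := derivative_linear (L := @lsubmx R 1 n n) (1 : R)
  (@continuous_lsubmx _ _ _ _) dc.
have [_ Dr] := derivative_linear (L := @rsubmx R 1 n n) (1 : R)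
  (@continuous_rsubmx _ _ _ _) dc.
congr row_mx.
  apply: (etrans (esym Dl)); congr ('D_1 _ s).
by apply/funext => r; exact: row_mxKl.
apply: (etrans (esym Dr)); congr ('D_1 _ s).
by apply/funext => r; exact: row_mxKr.
Qed.

(** The splitting of the velocity of a lifted curve into horizontal and vertical parts. *)
Lemma near_velocity : \forall s \near t,
  lsubmx (derive1 c s) = derive1 x s /\
  derive1 c s *m ver_mx g (c s) = cov_along g x X s.
Proof.
apply: filterS2 dx dX => s dxs dXs.
rewrite mul_ver_mx derive1_row_mx // !row_mxKl !row_mxKr; split=> //.
by rewrite addrC.
Qed.

(** Differentiating h(X', b) covariantly gives h(X'', b) and a term with the connection applied to
    the constant [b]. The same term comes from the dependence of [ver_mx] on the fibre coordinate,
    and they cancel. *)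
Lemma euler_lagrange_sasaki_vertical b :
  euler_lagrange S c t (row_mx 0 b) =
  bil (twin (x t)) (cov_along g x (cov_along g x X) t) b.
Proof.
have dxt := nbhs_singleton dx; have dXt := nbhs_singleton dX.
have [lc vc] := nbhs_singleton near_velocity.
have db : differentiable (cst b : R -> 'rV[R]_n) t by exact: differentiable_cst.
have cb : cov_along g x (cst b) t = derive1 x t *m conn_mx g (x t) b.
  by rewrite /cov_along derive1E derive_cst add0r.
have dcov : differentiable (cov_along g x X) t.
  by apply: (cov_along_differentiable oU Cg) => //; exact: metric_unit.
have E : \forall s \near t, bil (S (c s)) (derive1 c s) (row_mx 0 b) =
    bil (twin (x s)) (cov_along g x X s) (cst b s).
  by apply: filterS near_velocity => s [_ <-]; rewrite sasaki_vlift row_mxKl.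
have D := etrans (near_eq_derive (1 : R) E)
  (derive_bil_cov dxt (twin_differentiable Ux)
     (fun a b v => twin_compat a b v Ux) dcov db).
apply: (etrans (congr1 (fun r => r - _) D)).
rewrite derive_sasaki ?row_mxKl // !derive0 !bil0m !add0r.
rewrite derive_mul_ver_mx ?row_mxKl // lc vc.
rewrite cb.
rewrite [bil _ (_ *m conn_mx _ _ _) _](bil_sym _ _ (twin_sym Ux)) /cst.
by field.
Qed.

(** The vertical part of the velocity enters the energy quadratically, so its first-order
    contribution vanishes with it. Vanishing near [t] is assumed because the covector contains a
    time derivative. *)
Lemma euler_lagrange_sasaki_parallel u :
  (\forall s \near t, cov_along g x X s = 0) ->
  euler_lagrange S c t u = euler_lagrange g x t (lsubmx u).
Proof.
move=> cov0; have [lc vc] := nbhs_singleton near_velocity.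
have E : \forall s \near t, bil (S (c s)) (derive1 c s) u =
    bil (g (x s)) (derive1 x s) (lsubmx u).
  apply: filterS2 near_velocity cov0 => s [ls vs] cs.
  by rewrite sasaki_bilE !mul_hor_mx ls vs cs bil0l addr0 row_mxKl.
apply: (etrans (congr1 (fun r => r - _) (near_eq_derive (1 : R) E))).
rewrite derive_sasaki ?row_mxKl // lc vc (nbhs_singleton cov0).
by rewrite !bil0r mulr0 !addr0.
Qed.

End Curve.

End SasakiChart.

(** * Geodesics of a hypersurface *)

Section Hyperplane.
Variables (R : realType) (d : nat) (A : 'M[R]_d) (N : 'rV[R]_d).
Variable J : 'M[R]_(d.-1, d).
Hypotheses (freeJ : row_free J) (NN : bil A N N = 1)
  (tanJ : forall u, bil A (u *m J) N = 0).

Lemma tangent_preimage w : bil A w N = 0 -> exists u, w = u *m J.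
Proof.
pose C : 'cV[R]_d := A *m N^T.
have CE v : bil A v N = (v *m C) 0 0 by rewrite /bil mulmxA.
have mem v : bil A v N = 0 <-> v *m C = 0.
  by rewrite CE; split=> [v0|->]; [apply/rowP => i; rewrite ord1 v0 mxE|rewrite mxE].
have JK : (J <= kermx C)%MS.
  apply/row_subP => i; apply/sub_kermxP; apply/mem.
  by rewrite rowE; exact: tanJ.
have C0 : \rank C = 1%N.
  apply/eqP; rewrite eqn_leq rank_leq_col lt0n mxrank_eq0; apply/negP => /eqP C0.
  by move: NN; rewrite CE C0 mulmx0 mxE => /esym/eqP; rewrite oner_eq0.
have rK : \rank (kermx C) = \rank J.
  by rewrite mxrank_ker C0 subn1 (eqP freeJ).
have KJ : (kermx C <= J)%MS by rewrite -(mxrank_leqif_sup JK) rK.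
move=> /mem w0; have : (w <= J)%MS by apply: submx_trans KJ; exact/sub_kermxP.
by move=> /submxP[u ->]; exists u.
Qed.

(** For an indefinite [A] a hyperplane may be degenerate; the normal of square 1 excludes this, as
    every [w] is a tangent vector plus a multiple of [N]. *)
Lemma induced_unit : A \in unitmx -> J *m A *m J^T \in unitmx.
Proof.
move=> uA; apply: unitmx_inj => u u0; have {}u0 v : bil A (u *m J) (v *m J) = 0.
  by rewrite -bil_pull /bil u0 mul0mx mxE.
have uJ : u *m J = 0.
  apply: (bil_unit_eq0 uA) => w; pose a := bil A w N.
  have [v E] : exists v, w - a *: N = v *m J.
    by apply: tangent_preimage; rewrite bilDl bilNl bilZl NN mulr1 subrr.
  by rewrite -(subrK (a *: N) w) bilDr E u0 bilZr tanJ mulr0 addr0.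
by apply: (row_free_inj freeJ); rewrite uJ mul0mx.
Qed.

End Hyperplane.

Section Hypersurface.
Variables (R : realType) (d : nat) (S : set 'rV[R]_d).
Variables (A : 'rV[R]_d -> 'M[R]_d) (q : 'rV[R]_d -> R) (N : 'rV[R]_d -> 'rV[R]_d).
Hypotheses (qS : forall z, S z -> q z = 1)
  (dq : forall z, S z -> differentiable q z)
  (Dq : forall z w, S z -> 'D_w q z = 2 * bil (A z) w (N z))
  (NN : forall z, S z -> bil (A z) (N z) (N z) = 1)
  (symA : forall z, S z -> (A z)^T = A z)
  (unitA : forall z, S z -> A z \in unitmx)
  (dA : forall z, S z -> differentiable A z).
Variables (V : set 'rV[R]_d.-1) (W : set 'rV[R]_d).
Variables (F : 'rV[R]_d.-1 -> 'rV[R]_d) (H : 'rV[R]_d -> 'rV[R]_d.-1).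
Hypothesis chart : submfd_chart S V W F H.

Let oV : open V. Proof. by have [[]] := chart. Qed.
Let oW : open W. Proof. by have [[]] := chart. Qed.
Let CF k : Ck k V F. Proof. by have [_ + _ _ _] := chart; exact. Qed.
Let CH k : Ck k W H. Proof. by have [_ _ + _ _] := chart; exact. Qed.
Let dF y : V y -> differentiable F y.
Proof. exact: (Ck_differentiable (CF 1)). Qed.
Let nV y : V y -> \forall y' \near y, V y'.
Proof. by move=> Vy; exact: (open_nbhs_nbhs (conj oV Vy)). Qed.
Let FV y : V y -> S (F y) /\ W (F y).
Proof.
move=> Vy; have [_ _ _ FE _] := chart.
by have : (F @` V) (F y) by [exists y]; rewrite FE.
Qed.
Let HF y : V y -> H (F y) = y.
Proof. by have [_ _ _ _ +] := chart; exact. Qed.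

(** Differentiating [H \o F = id] shows that the Jacobian of [H] is a right inverse of ['J F y]. *)
Lemma chart_jacobian_free y : V y -> row_free ('J F y).
Proof.
move=> Vy; have [_ WF] := FV Vy; apply/row_freeP; exists ('J H (F y)).
apply/row_matrixP => i; rewrite !rowE mulmx1 mulmxA.
have dH : differentiable H (F y) by exact: (Ck_differentiable (CH 1)).
have E : \forall z \near y, (H \o F) z = id z by apply: filterS (nV Vy) => z /HF.
have := derive_comp (delta_mx 0 i) (dF Vy) dH.
rewrite (near_eq_derive _ E) derive_id (deriveEjacobian _ dH).
by rewrite (deriveEjacobian _ (dF Vy)) => <-.
Qed.

(** [q \o F] is constant on [V], and [N] is half the gradient of [q]. *)
Lemma chart_jacobian_tangent y u : V y -> bil (A (F y)) (u *m 'J F y) (N (F y)) = 0.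
Proof.
move=> Vy; have [SF _] := FV Vy.
have E : \forall z \near y, (q \o F) z = cst 1 z.
  by apply: filterS (nV Vy) => z /FV[/qS].
have := derive_comp u (dF Vy) (dq SF).
rewrite (near_eq_derive _ E) derive_cst (Dq _ SF) (deriveEjacobian _ (dF Vy)).
by move=> /esym/eqP; rewrite mulf_eq0 pnatr_eq0 /= => /eqP.
Qed.

Lemma induced_metric_unit y : V y -> induced_metric A F y \in unitmx.
Proof.
move=> Vy; have [SF _] := FV Vy.
apply: (induced_unit (chart_jacobian_free Vy) (NN SF)) (unitA SF) => u.
exact: chart_jacobian_tangent.
Qed.

(** The covector of the coordinate curve [H \o c] is the pullback by [F] of the ambient one, and the
    image of ['J F] is the whole hyperplane orthogonal to [N]. *)
Lemma hypersurface_geodesic (c : R -> 'rV[R]_d) (t : R) :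
  (\forall s \near t, S (c s)) -> W (c t) ->
  (\forall s \near t, differentiable c s) -> differentiable (derive1 c) t ->
  geodesic_at (induced_metric A F) (H \o c) t <->
  forall w, bil (A (c t)) w (N (c t)) = 0 -> euler_lagrange A c t w = 0.
Proof.
move=> Sc Wc dc ddc; have dct := nbhs_singleton dc.
have nW : \forall s \near t, W (c s).
  exact: (differentiable_continuous dct (open_nbhs_nbhs (conj oW Wc))).
(* Points of [S] in [W] lie in the image of [F], so there [H] is also a right inverse of [F]. *)
have VH s : S (c s) -> W (c s) -> V (H (c s)) /\ c s = F (H (c s)).
  move=> Ss Ws; have [_ _ _ FE _] := chart.
  have : (S `&` W) (c s) by [].
  by rewrite -FE => -[y Vy <-]; rewrite HF.
have Sct := nbhs_singleton Sc; have [Ve ctE] := VH t Sct Wc.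
have dH z : W z -> differentiable H z by exact: (Ck_differentiable (CH 1)).
have nE : \forall s \near t, (H \o c) s = H (c s) by apply: filterS nW.
have de : \forall s \near t, differentiable (H \o c) s.
  by apply: filterS2 nW dc => s Ws dcs; exact: (differentiable_comp dcs (dH _ Ws)).
(* The pullback lemma is used here in the opposite direction, with [H] as the map and [c] as the
   inner curve. *)
have dde : differentiable (derive1 (H \o c)) t.
  exact: (differentiable_pullback oW (CH 2) Wc dc ddc nE).
have cE : \forall s \near t, c s = F ((H \o c) s).
  by apply: filterS2 Sc nW => s Ss Ws; have [] := VH s Ss Ws.
have dI : differentiable (induced_metric A F) ((H \o c) t).
  exact: (induced_metric_differentiable oV (CF 2) Ve cE (dA Sct)).
have sI : \forall y \near (H \o c) t, (induced_metric A F y)^T = induced_metric A F y.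
  apply: filterS (nV Ve) => y Vy; apply: trmx_congruence.
  by apply: symA; have [] := FV Vy.
have pull u : euler_lagrange (induced_metric A F) (H \o c) t u =
    euler_lagrange A c t (u *m 'J F ((H \o c) t)).
  exact: (euler_lagrange_pullback oV (CF 2) Ve de dde cE (dA Sct) (symA Sct)).
rewrite (geodesic_euler_lagrange (nbhs_singleton de) dI dde (induced_metric_unit Ve) sI).
split=> [EL w wN|EL u].
  have [|u ->] := tangent_preimage (chart_jacobian_free Ve) (NN (FV Ve).1)
     (fun u => chart_jacobian_tangent u Ve) (w := w); first by rewrite -ctE.
  by rewrite -pull.
rewrite pull; apply: EL; rewrite [in A _]ctE [in N _]ctE.
exact: chart_jacobian_tangent.
Qed.

End Hypersurface.

(** * An explicit chart of a level set of fibre quadrics *)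

Section ChartTools.
Variable R : realType.

Lemma Ck_scale (V W : normedModType R) k (S : set V) (a : V -> R) (f : V -> W) :
  open S -> Ck k S a -> Ck k S f -> Ck k S (fun x => a x *: f x).
Proof.
have bl : bilinear_for (GRing.Scale.Law.clone _ _ *:%R _)
    (GRing.Scale.Law.clone _ _ *:%R _) (fun (r : R) (w : W) => r *: w).
  split=> [w|r] b x y /=.
    by rewrite scalerDl -scalerA.
  by rewrite scalerDr !scalerA mulrC.
pose BM := bilinear_isBilinear.Build R R W W _ _ (fun (r : R) (w : W) => r *: w) bl.
pose B : {bilinear R -> W -> W} := HB.pack (fun (r : R) (w : W) => r *: w) BM.
move=> oS; apply: (@Ck_bilinear _ _ _ _ _ _ _ B) => // p.
exact: scale_continuous.
Qed.

Lemma open_positive (V : normedModType R) (S : set V) (a : V -> R) :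
  open S -> Ck 0 S a -> open [set z | S z /\ 0 < a z].
Proof.
move=> oS Ca; rewrite openE => z [Sz az].
have nS : \forall y \near z, S y by exact: (open_nbhs_nbhs (conj oS Sz)).
have na : \forall y \near z, 0 < a y.
  have na : \forall r \near a z, 0 < r by exact: (open_nbhs_nbhs (conj (@open_gt R 0) az)).
  exact: (Ca z Sz _ na).
by apply: filterS2 nS na.
Qed.

Lemma Ck_trmx (V : normedModType R) m n k (S : set V) (f : V -> 'M[R]_(m, n)) :
  open S -> Ck k S f -> Ck k S (fun x => (f x)^T).
Proof.
move=> oS; apply: (Ck_linear (L := @trmx R m n)) => //.
exact: linear_mx_continuous.
Qed.

Lemma Ck_mulmxr (V : normedModType R) m n p k (S : set V) (f : V -> 'M[R]_(m, n))
    (B : 'M[R]_(n, p)) :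
  open S -> Ck k S f -> Ck k S (fun x => f x *m B).
Proof. by move=> oS Cf; apply: Ck_mulmx => //; exact: Ck_cst. Qed.

Lemma hyperplane_basis d (L : 'cV[R]_d) : L != 0 ->
  exists B : 'M[R]_(d.-1, d), exists B' : 'M[R]_(d, d.-1),
  [/\ B *m B' = 1%:M, B *m L = 0
    & forall w : 'rV_d, w *m L = 0 -> w *m B' *m B = w].
Proof.
move=> L0; have rK : \rank (kermx L) = d.-1.
  rewrite mxrank_ker (_ : \rank L = 1%N) ?subn1 //.
  by apply/eqP; rewrite eqn_leq rank_leq_col lt0n mxrank_eq0.
have : (row_base (kermx L) :=: kermx L)%MS := eq_row_base _.
have := row_base_free (kermx L).
(* Generalizing over the basis allows its number of rows, a rank, to be rewritten into [d.-1]. *)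
move: (row_base _); rewrite rK => B freeB BK; exists B, (pinvmx B).
split; first exact: mulmxVp.
  by apply/sub_kermxP; rewrite BK.
by move=> w w0; rewrite mulmxKpV // BK; exact/sub_kermxP.
Qed.

End ChartTools.

Section RadialChart.
Variables (R : realType) (n : nat) (U : set 'rV[R]_n) (h : 'rV[R]_n -> 'M[R]_n).
Hypotheses (oU : open U) (Ch : smooth_on U h).
Variable z0 : 'rV[R]_(n + n).

Let q (z : 'rV[R]_(n + n)) : R := bil (h (lsubmx z)) (rsubmx z) (rsubmx z).

Hypotheses (Uz0 : U (lsubmx z0)) (qz0 : q z0 = 1).

Let S := [set z | U (lsubmx z) /\ q z = 1].
Let O := [set z : 'rV[R]_(n + n) | U (lsubmx z)].

Let oO : open O.
Proof. by apply: open_comp oU => z _; exact: continuous_lsubmx. Qed.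

Let CqO k : Ck k O q.
Proof.
have Cr : Ck k O (@rsubmx R 1 n n).
  apply: (Ck_linear (L := @rsubmx R 1 n n)) => //; first exact: continuous_rsubmx.
  exact: Ck_id.
have Ch' : Ck k O (fun z => h (lsubmx z)).
  have C := Ck_comp_affine (L := @lsubmx R 1 n n) 0 oU
    (@continuous_lsubmx _ _ _ _) (Ch k).
  have E : [set x | U (0 + lsubmx x)] = O.
    by apply/funext => x; rewrite /= add0r.
  rewrite E in C; apply: Ck_ext C => // x _; by rewrite add0r.
by apply: Ck_mx_entry => //; do 2?apply: Ck_mulmx => //; exact: Ck_trmx.
Qed.

(** [lev] is the fibrewise differential of [q / 2] at [z0]. Its coefficients are frozen at the base
    point of [z0], so it is linear in all coordinates, and [lev z0 = q z0 = 1]. *)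
Let l : 'cV[R]_n := h (lsubmx z0) *m (rsubmx z0)^T.
Let L : 'cV[R]_(n + n) := col_mx 0 l.
Let lev (z : 'rV[R]_(n + n)) : R := (z *m L) 0 0.

Let levE z : lev z = (rsubmx z *m l) 0 0.
Proof. by rewrite /lev -{1}(hsubmxK z) mul_row_col mulmx0 add0r. Qed.

Let lev0 : lev z0 = 1. Proof. by rewrite levE /l mulmxA. Qed.

Let rad (r : R) (z : 'rV[R]_(n + n)) := row_mx (lsubmx z) (r *: rsubmx z).

(** This form exhibits the rescaling as sums, scalings and constant matrix products, to which the
    closure lemmas for [Ck] apply. *)
Let radE r z : rad r z = z *m block_mx 1%:M 0 0 0 + r *: (z *m block_mx 0 0 0 1%:M).
Proof.
rewrite /rad -{3 4}(hsubmxK z) !mul_row_block !mulmx0 !mulmx1 !addr0 !add0r.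
by rewrite scale_row_mx scaler0 add_row_mx addr0 add0r.
Qed.

Let q_rad r z : q (rad r z) = r ^+ 2 * q z.
Proof. by rewrite /q /rad row_mxKl row_mxKr bilZl bilZr mulrA. Qed.

Let lev_rad r z : lev (rad r z) = r * lev z.
Proof. by rewrite !levE /rad row_mxKr -scalemxAl mxE. Qed.

Let radM r s z : rad r (rad s z) = rad (r * s) z.
Proof. by rewrite /rad row_mxKl row_mxKr scalerA. Qed.

Let rad1 z : rad 1 z = z.
Proof. by rewrite /rad scale1r hsubmxK. Qed.

Let Ck_rad (V' : normedModType R) k (T : set V') (r : V' -> R)
    (f : V' -> 'rV[R]_(n + n)) :
  open T -> Ck k T r -> Ck k T f -> Ck k T (fun y => rad (r y) (f y)).
Proof.
move=> oT Cr Cf; have C : Ck k T (fun y => f y *m block_mx 1%:M 0 0 0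
    + r y *: (f y *m block_mx 0 0 0 1%:M)).
  by apply: Ck_add => //; [|apply: Ck_scale => //]; exact: Ck_mulmxr.
by apply: Ck_ext C => // y _; rewrite radE.
Qed.

(* The fibres of the level set are quadrics, so near z0 it is the image of the
   affine hyperplane lev = 1 under the radial rescaling of the fibres. *)
Lemma radial_chart : exists V W F H,
  @submfd_chart R (n + n) (n + n).-1 S V W F H /\ W z0.
Proof.
have L0 : L != 0.
  apply/eqP => L0; move: lev0; rewrite /lev L0 mulmx0 mxE => /esym/eqP.
  by rewrite oner_eq0.
have [B [B' [BB' BL B'B]]] := hyperplane_basis L0.
pose Z (y : 'rV[R]_(n + n).-1) := z0 + mulmxr B y.
have levZ y : lev (Z y) = 1.
  by rewrite /lev mulmxDl mxE -/(lev z0) lev0 /= -mulmxA BL mulmx0 mxE addr0.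
pose P := [set z | O z /\ 0 < q z].
have oP : open P by exact: open_positive oO (CqO 0).
have cB : continuous (mulmxr B : 'rV[R]_(n + n).-1 -> _) by exact: linear_mx_continuous.
have cZ y : {for y, continuous Z}.
  by apply: (@continuousD _ _ _ (cst z0)); [exact: cst_continuous|exact: cB].
pose V := [set y | P (Z y)].
have oV : open V by apply: open_comp oP => y _; exact: cZ.
pose W := [set z | O z /\ 0 < lev z].
have Clev k (T : set 'rV[R]_(n + n)) : open T -> Ck k T lev.
  by move=> oT; apply: Ck_mx_entry => //; apply: Ck_mulmxr => //; exact: Ck_id.
have oW : open W by exact: open_positive oO (Clev 0 O oO).
(* Since [q] is homogeneous of degree 2 on the fibres, this factor brings [Z y] to the level 1. *)
pose rho y := (Num.sqrt (q (Z y)))^-1.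
have rho0 y : V y -> 0 < rho y by move=> [_ qy]; rewrite invr_gt0 sqrtr_gt0.
pose F y := rad (rho y) (Z y).
(* Since [lev (F y) = rho y], dividing by [lev] undoes the rescaling; [B'] then reads the
   coordinates in the hyperplane. *)
pose H z := (rad (lev z)^-1 z - z0) *m B'.
exists V, W, F, H; split; last by split=> //=; rewrite lev0 ltr01.
have HF y : V y -> H (F y) = y.
  move=> Vy; have r0 := rho0 y Vy.
  rewrite /H /F lev_rad levZ mulr1 radM mulVf ?gt_eqF // rad1.
  by rewrite /Z addrAC subrr add0r /= -mulmxA BB' mulmx1.
split=> //.
- move=> k; apply: Ck_rad => //.
    apply: Ck_inv => //; last first.
      apply: Ck_sqrt => //; first by move=> y [].
      by apply: (Ck_comp_affine (L := mulmxr B)) => //; apply: Ck_subset (CqO k) => z [].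
    by move=> y [_ qy]; rewrite gt_eqF // sqrtr_gt0.
  apply: Ck_add => //; first exact: Ck_cst.
  by apply: Ck_mulmxr => //; exact: Ck_id.
- move=> k; apply: Ck_mulmxr => //; apply: Ck_add => //; last exact: Ck_cst.
  apply: Ck_rad => //; last exact: Ck_id.
  by apply: Ck_inv; [|move=> z [_ lz]; rewrite gt_eqF|exact: Clev].
apply/seteqP; split=> [_ [y Vy <-]|z [[Uz qz] [_ lz]]].
  have r0 := rho0 y Vy; have [OZ qZ] := Vy.
  have OF : U (lsubmx (F y)) by rewrite /F /rad row_mxKl.
  split; split=> //; last by rewrite lev_rad levZ mulr1.
  by rewrite q_rad exprVn sqr_sqrtr ?ltW // mulVf // gt_eqF.
have ZH : Z (H z) = rad (lev z)^-1 z.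
  have w0 : (rad (lev z)^-1 z - z0) *m L = 0.
    apply/rowP => i; rewrite ord1 mulmxBl [LHS]mxE [X in _ + X]mxE.
    by rewrite -/(lev _) -/(lev z0) lev_rad lev0 mulVf ?gt_eqF // subrr mxE.
  by rewrite /Z /H /= B'B // addrC subrK.
exists (H z).
  split; rewrite /= ZH; first by rewrite /O /= /rad row_mxKl.
  by rewrite q_rad qz mulr1 exprn_gt0 // invr_gt0.
rewrite /F /rho ZH q_rad qz mulr1 sqrtr_sqr ger0_norm ?invr_ge0 ?ltW // invrK.
by rewrite radM mulfV ?gt_eqF // rad1.
Qed.

End RadialChart.

(** * Natural lifts *)

Section NaturalLift.
Variables (R : realType) (n : nat) (U : set 'rV[R]_n).
Variables g phi : 'rV[R]_n -> 'M[R]_n.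
Hypotheses (oU : open U) (Cg : smooth_on U g) (Cphi : smooth_on U phi).
Hypothesis g_sym : forall x, U x -> (g x)^T = g x.
Hypothesis g_pos : forall x, U x -> forall v, v != 0 -> 0 < bil (g x) v v.
Hypothesis phi_invol : forall x, U x -> phi x *m phi x = 1%:M.
Hypothesis phi_selfadj : forall x, U x -> forall v w,
  bil (g x) (v *m phi x) w = bil (g x) v (w *m phi x).
Hypothesis phi_parallel : forall x, U x ->
  forall k a b, nabla_endo g phi x k a b = 0.

Notation h := (twin g phi).
Notation Sas := (sasaki g phi).
Let S := [set z : 'rV[R]_(n + n) | U (lsubmx z) /\ fiber_form g phi z = 1].

Variables (T : set R) (x : R -> 'rV[R]_n).
Hypotheses (oT : open T) (Cx : smooth_on T x) (xU : forall t, T t -> U (x t)).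

Let X := derive1 x.
Let c s := row_mx (x s) (X s).
Let eta := cov_along g x X.

Hypothesis unitX : forall t, T t -> bil (h (x t)) (X t) (X t) = 1.

Let ug := metric_unit g_pos.
Let uh := twin_unit g_pos phi_invol.
Let sh := twin_sym g_sym phi_selfadj.

Let nT t : T t -> \forall s \near t, T s.
Proof. by move=> Tt; exact: (open_nbhs_nbhs (conj oT Tt)). Qed.

Let CX k : Ck k T X.
Proof.
rewrite (_ : X = 'D_1 x); last by apply/funext => s; exact: derive1E.
exact: (Ck_derive (1 : R) (Cx k.+1)).
Qed.

Let CdX k : Ck k T (derive1 X).
Proof.
rewrite (_ : derive1 X = 'D_1 X); last by apply/funext => s; exact: derive1E.
exact: (Ck_derive (1 : R) (CX k.+1)).
Qed.

Let dx t : T t -> differentiable x t.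
Proof. exact: (Ck_differentiable (Cx 1)). Qed.
Let dX t : T t -> differentiable X t.
Proof. exact: (Ck_differentiable (CX 1)). Qed.
Let ddX t : T t -> differentiable (derive1 X) t.
Proof. exact: (Ck_differentiable (CdX 1)). Qed.
Let ndx t : T t -> \forall s \near t, differentiable x s.
Proof. by move=> /nT; apply: filterS => s /dx. Qed.
Let ndX t : T t -> \forall s \near t, differentiable X s.
Proof. by move=> /nT; apply: filterS => s /dX. Qed.
Let deta t : T t -> differentiable eta t.
Proof.
move=> Tt; apply: (cov_along_differentiable oU (Cg 2) ug (xU Tt) (dx Tt) (dX Tt)).
  exact: dX.
exact: ddX.
Qed.

Let cS t : T t -> S (c t).
Proof.
move=> Tt; split; rewrite /fiber_form ?row_mxKl ?row_mxKr; first exact: xU.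
exact: unitX.
Qed.

Let dc t : T t -> differentiable c t.
Proof. by move=> Tt; apply: row_mx_differentiable; [exact: dx|exact: dX]. Qed.

Let ddc t : T t -> differentiable (derive1 c) t.
Proof.
move=> Tt; apply: (@near_eq_differentiable _ _ _ (fun s => row_mx (X s) (derive1 X s))).
  by apply: filterS (nT Tt) => s Ts; rewrite derive1_row_mx //; [exact: dx|exact: dX].
by apply: row_mx_differentiable; [exact: dX|exact: ddX].
Qed.

Let normal_unit z : S z -> bil (Sas z) (vlift (rsubmx z)) (vlift (rsubmx z)) = 1.
Proof.
move=> [Uz qz]; rewrite sasaki_vlift mul_ver_mx /vlift row_mxKl row_mxKr.
by rewrite mul0mx add0r.
Qed.

(** The hypersurface criterion with the tautological vertical field as normal: by
    [derive_fiber_form] it is half the gradient of [fiber_form]. *)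
Let chart_geodesic t V W F H :
  T t -> @submfd_chart R (n + n) (n + n).-1 S V W F H -> W (c t) ->
  geodesic_at (induced_metric Sas F) (H \o c) t <->
  forall w, bil (Sas (c t)) w (vlift (rsubmx (c t))) = 0 ->
    euler_lagrange Sas c t w = 0.
Proof.
move=> Tt ch Wc.
apply: (@hypersurface_geodesic _ _ S Sas (fiber_form g phi) (fun z => vlift (rsubmx z))
  _ _ _ normal_unit _ _ _ V W F H ch c t _ Wc _ (ddc Tt)).
- by move=> z [].
- by move=> z [Uz _]; have [] := derive_fiber_form oU (Cg 2) (Cphi 1) g_sym g_pos
    phi_selfadj phi_parallel 0 Uz.
- by move=> z w [Uz _]; have [] := derive_fiber_form oU (Cg 2) (Cphi 1) g_sym g_pos
    phi_selfadj phi_parallel w Uz.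
- by move=> z [Uz _]; exact: (sasaki_sym g_sym phi_selfadj Uz).
- by move=> z [Uz _]; exact: (sasaki_unit g_pos phi_invol Uz).
- by move=> z [Uz _]; exact: (sasaki_differentiable oU (Cg 2) (Cphi 1) g_pos Uz).
- by apply: filterS (nT Tt) => s /cS.
- by apply: filterS (nT Tt) => s /dc.
Qed.

(** A geodesic has parallel velocity, so the velocity of its lift is horizontal, and the
    Euler-Lagrange covector of the lift vanishes on all ambient vectors. *)
Lemma geodesic_natural_lift : (forall t, T t -> geodesic_at g x t) ->
  forall t, T t -> @submfd_geodesic_at R (n + n) (n + n).-1 S Sas c t.
Proof.
move=> geo t Tt V W F H ch Wc; apply/(chart_geodesic Tt ch Wc) => w _.
have eta0 : \forall s \near t, cov_along g x X s = 0.
  by apply: filterS (nT Tt) => s /geo.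
rewrite (euler_lagrange_sasaki_parallel oU (Cg 2) (Cphi 1) g_sym g_pos
  phi_selfadj (ndx Tt) (ndX Tt) (xU Tt) w eta0).
have dg : differentiable g (x t) by exact: (Ck_differentiable (Cg 1) (xU Tt)).
have sg : \forall y \near x t, (g y)^T = g y.
  by apply: filterS (open_nbhs_nbhs (conj oU (xU Tt))) => y /g_sym.
by have [E _] := geodesic_euler_lagrange (dx Tt) dg (dX Tt) (ug (xU Tt)) sg; apply/E/geo.
Qed.

Hypothesis natX : forall t, T t -> bil (Sas (c t)) (derive1 c t) (derive1 c t) = 1.
Hypothesis lift_geo : forall t, T t ->
  @submfd_geodesic_at R (n + n) (n + n).-1 S Sas c t.

(** The condition on [b] says that its vertical lift is tangent to the level set. The chart needed
    to use [lift_geo] comes from [radial_chart]. *)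
Let vertical t b : T t -> bil (h (x t)) b (X t) = 0 ->
  bil (h (x t)) (cov_along g x eta t) b = 0.
Proof.
move=> Tt bX.
have Ch : smooth_on U h.
  by move=> k; apply: Ck_mulmx => //; apply: Ck_trmx.
have [V [W [F [H [ch Wc]]]]] := radial_chart oU Ch (cS Tt).1 (cS Tt).2.
have /(chart_geodesic Tt ch Wc)/(_ (row_mx 0 b)) := lift_geo Tt ch Wc.
rewrite (euler_lagrange_sasaki_vertical oU (Cg 2) (Cphi 1) g_sym g_pos phi_selfadj
  phi_parallel (ndx Tt) (ndX Tt) (dX Tt) (ddX Tt) (xU Tt)); apply.
rewrite sasaki_vlift mul_ver_mx !row_mxKl !row_mxKr mul0mx add0r.
exact: bX.
Qed.

Let D_h Y Z t : T t -> differentiable Y t -> differentiable Z t ->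
  'D_1 (fun s => bil (h (x s)) (Y s) (Z s)) t =
  bil (h (x t)) (cov_along g x Y t) (Z t) + bil (h (x t)) (Y t) (cov_along g x Z t).
Proof.
move=> Tt dY dZ; have Ux := xU Tt; apply: (derive_bil_cov (dx Tt)) => //.
  exact: (twin_differentiable (Cg 2) (Cphi 1) Ux).
by move=> a b v; exact: (twin_compat oU (Cg 2) (Cphi 1) g_sym g_pos phi_parallel).
Qed.

Let D_g Y Z t : T t -> differentiable Y t -> differentiable Z t ->
  'D_1 (fun s => bil (g (x s)) (Y s) (Z s)) t =
  bil (g (x t)) (cov_along g x Y t) (Z t) + bil (g (x t)) (Y t) (cov_along g x Z t).
Proof.
move=> Tt dY dZ; have Ux := xU Tt.
have dg : differentiable g (x t) by exact: (Ck_differentiable (Cg 1) Ux).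
apply: (derive_bil_cov (dx Tt) dg) => //; apply: (conn_metric dg (ug Ux)).
by apply: filterS (open_nbhs_nbhs (conj oU Ux)) => y /g_sym.
Qed.

Let D_const (f : R -> R) a t : T t -> (forall s, T s -> f s = a) -> 'D_1 f t = 0.
Proof.
move=> Tt fa; have E : \forall s \near t, f s = cst a s.
  by apply: filterS (nT Tt) => s /fa.
by apply: (etrans (near_eq_derive (1 : R) E)); rewrite derive_cst.
Qed.

Let h_eta_X t : T t -> bil (h (x t)) (eta t) (X t) = 0.
Proof.
move=> Tt; have := D_const Tt unitX; rewrite D_h //; try exact: dX.
rewrite (bil_sym _ (cov_along _ _ _ _) (sh (xU Tt))) -mulr2n => /eqP.
by rewrite mulrn_eq0 /= => /eqP; rewrite (bil_sym _ _ (sh (xU Tt))).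
Qed.

Let energy t : T t ->
  bil (g (x t)) (X t) (X t) + bil (h (x t)) (eta t) (eta t) = 1.
Proof.
move=> Tt; rewrite -(natX Tt) sasaki_bilE !mul_hor_mx.
have [-> ->] := nbhs_singleton (near_velocity g (ndx Tt) (ndX Tt)).
by rewrite row_mxKl.
Qed.

Let g_eta_X t : T t -> bil (g (x t)) (eta t) (X t) = 0.
Proof.
move=> Tt; have := D_const Tt energy.
have dgX : differentiable (fun s => bil (g (x s)) (X s) (X s)) t.
  apply: differentiable_bil; try exact: dX.
  apply: (differentiable_comp (dx Tt)); exact: (Ck_differentiable (Cg 1) (xU Tt)).
have dhe : differentiable (fun s => bil (h (x s)) (eta s) (eta s)) t.
  apply: differentiable_bil; try exact: deta.
  apply: (differentiable_comp (dx Tt)).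
  exact: (twin_differentiable (Cg 2) (Cphi 1) (xU Tt)).
move/(etrans (esym (derive_add (1 : R) dgX dhe))).
rewrite D_g; [|by []|exact: dX|exact: dX].
rewrite D_h; [|by []|exact: deta|exact: deta].
rewrite [bil _ (eta t) (cov_along _ _ _ _)](bil_sym _ _ (sh (xU Tt))).
(* By [h_eta_X] the acceleration [eta] is itself an admissible test vector, which removes the
   derivative of the vertical energy. *)
rewrite (vertical Tt (h_eta_X Tt)) !addr0.
rewrite [bil _ (X t) (cov_along _ _ _ _)](bil_sym _ _ (g_sym (xU Tt))) -mulr2n => /eqP.
by rewrite mulrn_eq0 /= => /eqP.
Qed.

Lemma natural_lift_geodesic t : T t -> geodesic_at g x t.
Proof.
move=> Tt; have Ux := xU Tt; rewrite /geodesic_at -/X -/(eta t).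
set nu := bil (h (x t)) (eta t) (eta t).
have e1 : bil (h (x t)) (cov_along g x eta t) (X t) = - nu.
  have := D_const Tt h_eta_X; rewrite D_h; [|by []|exact: deta|exact: dX].
  by move/eqP; rewrite addr_eq0 => /eqP.
have covE : cov_along g x eta t = - nu *: X t.
  apply/eqP; rewrite -subr_eq0; apply/eqP; apply: (bil_unit_eq0 (uh Ux)) => w.
  (* The component of [w] orthogonal to [X t] for the twin metric, in which [X t] has square 1. *)
  pose b := w - bil (h (x t)) w (X t) *: X t.
  have bX : bil (h (x t)) b (X t) = 0.
    by rewrite bilDl bilNl bilZl unitX // mulr1 subrr.
  have := vertical Tt bX; rewrite bilDr bilNr bilZr e1 => E.
  rewrite bilDl bilNl bilZl (bil_sym (X t) _ (sh Ux)).
  by rewrite -[RHS]E; ring.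
have e2 : bil (g (x t)) (eta t) (eta t) = nu * bil (g (x t)) (X t) (X t).
  have := D_const Tt g_eta_X; rewrite D_g; [|by []|exact: deta|exact: dX].
  by rewrite covE bilZl mulNr addrC => /eqP; rewrite subr_eq0 => /eqP.
have ge0 v : 0 <= bil (g (x t)) v v.
  by have [->|/(g_pos Ux)/ltW//] := eqVneq v 0; rewrite bil0l.
have X1 : 1 <= bil (g (x t)) (X t) (X t).
  (* By self-adjointness and phi being an involution this square is 2 g(X, X) - 2 g(X, phi X), where
     g(X, phi X) = 1. *)
  have := ge0 (X t - X t *m phi (x t)).
  rewrite bilDl !bilDr !bilNl !bilNr !phi_selfadj //.
  by rewrite -mulmxA phi_invol // mulmx1 -!twinE unitX //; lra.
have nu0 : nu <= 0 by have := energy Tt; rewrite -/nu; lra.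
(* A nonzero [eta t] would have positive square, while [e2] expresses this square as [nu <= 0] times
   a nonnegative number. *)
apply/eqP/negPn/negP => /(g_pos Ux); rewrite e2 ltNge => /negP; apply.
by apply: mulr_le0_ge0.
Qed.

End NaturalLift.

Theorem corollary4p5 (R : realType) (m : nat) (M : para_kahler_norden R m)
    (I : set R) (gamma : R -> M)
    (I_open : open I) (I_interval : is_interval I)
    (gamma_smooth : smooth_curve I gamma)
    (Gamma_unit : lies_in_phi_unit I gamma (velocity gamma))
    (Gamma_natural : naturally_parameterized I gamma (velocity gamma)) :
  phi_unit_geodesic I gamma (velocity gamma) <-> geodesic I gamma.
Proof.
have [cgamma sgamma] := gamma_smooth.
(* Both properties are local in time, so everything happens on the open set of times at which the
   curve is in the chart [i]. *)
pose T i := I `&` gamma @^-1` mdom i.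
have oT i : open (T i).
  rewrite openE => t [It dt].
  have nI : \forall s \near t, I s by exact: (open_nbhs_nbhs (conj I_open It)).
  have nd : \forall s \near t, mdom i (gamma s).
    exact: (cgamma t It _ (open_nbhs_nbhs (conj (@mdom_open _ _ M i) dt))).
  by apply: filterS2 nI nd.
have xU i t : T i t -> mimg i ((mcoord i \o gamma) t).
  by move=> [_ dt]; exists (gamma t).
have oU i : open (@mimg R (2 * m) M i) by exact: mcoord_open.
have SE (i : mchart M) : phi_unit i = [set z | mimg i (lsubmx z) /\
    fiber_form (metric i) (phi i) z = 1].
  by apply/funext => z; rewrite /phi_unit /fiber_form /mkset twinE.
have unit i t : T i t -> bil (twin (metric i) (phi i) ((mcoord i \o gamma) t))
    (velocity gamma i t) (velocity gamma i t) = 1.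
  move=> [It dt]; have := Gamma_unit t i It dt.
  by rewrite SE /fiber_form => -[_]; rewrite /= row_mxKl row_mxKr.
split=> [lift_geo t i It dt|geo t i It dt].
  apply: (natural_lift_geodesic (oU i) (@Defs.metric_smooth _ _ M i)
    (@phi_smooth _ _ M i)
    (@Defs.metric_sym _ _ M i) (@Defs.metric_pos _ _ M i) (@phi_invol _ _ M i)
    (@phi_selfadj _ _ M i) (@phi_parallel _ _ M i) (oT i) (sgamma i)
    (xU i) (unit i)) => //.
    by move=> s [Is ds]; exact: (Gamma_natural s i Is ds).
  by move=> s [Is ds]; have := lift_geo s i Is ds; rewrite SE.
rewrite SE.
apply: (geodesic_natural_lift (oU i) (@Defs.metric_smooth _ _ M i)
    (@phi_smooth _ _ M i)
  (@Defs.metric_sym _ _ M i) (@Defs.metric_pos _ _ M i) (@phi_invol _ _ M i)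
  (@phi_selfadj _ _ M i) (@phi_parallel _ _ M i) (oT i) (sgamma i)
    (xU i) (unit i)) => //.
by move=> s [Is ds]; exact: (geo s i Is ds).
Qed.
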